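(* When the input DAG is a directed path with $n$ vertices, ESP-DAG with $k$ machines can be solved in time $O(n\cdot k^3\cdot M)$, where $M$ is the number of bits needed to encode the largest value of the functions $p$ and $q$.
   Context: $[k]=\{1,\dots,k\}$. For a digraph $G$ and $v\in V(G)$, $N^+_G(v)=\{u : (v,u)\in A(G)\}$; for $S\subseteq V(G)$, $\mathbf{1}_G(v,S)=1$ if $N^+_G(v)\cap S\neq\emptyset$ and $0$ otherwise. For $f:V(G)\to[k]$ and $q:V(G)\to\mathbb{R}_{\geq 0}$, $\mathrm{tr}(f,q,G)=\sum_{i\in[k]}\sum_{v\in f^{-1}(i)}\sum_{j\in[k]\setminus\{i\}} q(v)\cdot \mathbf{1}_G(v,f^{-1}(j))$. ESP-DAG with $k$ machines: given a DAG $G$, $p:V(G)\times[k]\to\mathbb{R}_{\geq 0}$, $q:V(G)\to\mathbb{R}_{\geq 0}$ and a rational $r$, decide whether some $f:V(G)\to[k]$ satisfies $\sum_{v} p(v,f(v))+\mathrm{tr}(f,q,G)\leq r$. *)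

(* Defs.v *)
From mathcomp Require Import all_boot all_order all_algebra perm.
Set Implicit Arguments.
Unset Strict Implicit.
Unset Printing Implicit Defensive.
Import Order.TTheory GRing.Theory Num.Theory.

Section Problem.
Local Open Scope ring_scope.
Variables (R : realFieldType) (V : finType) (k : nat).
Implicit Types (e : rel V) (f : {ffun V -> 'I_k}) (p : V -> 'I_k -> R).
Implicit Types (q : V -> R).

(* A digraph on V is its arc relation e; machines are numbered from 0. *)
Definition out_nbhd e (v : V) : {set V} := [set u | e v u].

Definition hits e (v : V) (S : {set V}) : bool := out_nbhd e v :&: S != set0.

Definition tr f q e : R :=
  \sum_(i < k) \sum_(v in f @^-1: [set i]) \sum_(j < k | j != i)
    q v * (hits e v (f @^-1: [set j]))%:R.

Definition esp_dag e p q (r : rat) : Prop :=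
  exists f, \sum_v p v (f v) + tr f q e <= ratr r.

End Problem.

(* The vertex names of the path are arbitrary: s v is the position of v. *)
Definition dipath n (e : rel 'I_n) : Prop :=
  exists s : {perm 'I_n}, forall u v, e u v = (s v == (s u).+1 :> nat).

Definition acyclic (V : finType) (e : rel V) : Prop :=
  forall u v, e u v -> ~~ connect e v u.

Lemma dipath_acyclic n (e : rel 'I_n) : dipath e -> acyclic e.
Proof.
case=> s es u v euv; apply/negP => /connectP[c pc lc].
have mono x : path e x c -> s x <= s (last x c).
  elim: c {pc lc} x => //= y c IH x /andP[exy /IH]; apply: leq_trans.
  by move: exy; rewrite es => /eqP->.
by have := mono v pc; rewrite -lc; move: euv; rewrite es => /eqP->; rewrite ltnn.
Qed.

(* A unit-cost word RAM with words of w bits.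
   A store consists of registers and of arrays, indexed by words and holding
   words.  A program mentions finitely many registers and arrays, and it does
   not depend on w.  Every operation is on words, modulo 2 ^ w, and costs 1, so
   a number of more than w bits has to be handled word by word. *)
Section Machine.

Inductive binop := Add | Sub | Mul | Lt | Eq.

Inductive expr :=
| Const of nat
| Var of nat
| Get of nat & expr
| Op of binop & expr & expr.

Inductive cmd :=
| Skip
| Assign of nat & expr
| Put of nat & expr & expr
| Seq of cmd & cmd
| If of expr & cmd & cmd
| While of expr & cmd.

Record store := Store { vars : nat -> nat; arrs : nat -> nat -> nat }.

Definition upd T (g : nat -> T) (x : nat) (y : T) : nat -> T :=
  fun z => if z == x then y else g z.

Definition set_var (s : store) x y := Store (upd (vars s) x y) (arrs s).

Definition set_arr (s : store) a i y :=
  Store (vars s) (upd (arrs s) a (upd (arrs s a) i y)).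

Variable w : nat.

Definition binop_sem (o : binop) (x y : nat) : nat :=
  match o with
  | Add => (x + y) %% 2 ^ w
  | Sub => (x + (2 ^ w - y)) %% 2 ^ w
  | Mul => (x * y) %% 2 ^ w
  | Lt => x < y
  | Eq => x == y
  end.

Fixpoint eval (s : store) (t : expr) : nat :=
  match t with
  | Const x => x %% 2 ^ w
  | Var x => vars s x
  | Get a t1 => arrs s a (eval s t1)
  | Op o t1 t2 => binop_sem o (eval s t1) (eval s t2)
  end.

Fixpoint cost (t : expr) : nat :=
  match t with
  | Const _ | Var _ => 1
  | Get _ t1 => (cost t1).+1
  | Op _ t1 t2 => (cost t1 + cost t2).+1
  end.

(* exec c s t s' : started in s, the command c halts in s' after t steps. *)
Inductive exec : cmd -> store -> nat -> store -> Prop :=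
| ExecSkip s : exec Skip s 1 s
| ExecAssign s x t : exec (Assign x t) s (cost t).+1 (set_var s x (eval s t))
| ExecPut s a t1 t2 :
    exec (Put a t1 t2) s (cost t1 + cost t2).+1
      (set_arr s a (eval s t1) (eval s t2))
| ExecSeq c1 c2 s1 s2 s3 m1 m2 :
    exec c1 s1 m1 s2 -> exec c2 s2 m2 s3 -> exec (Seq c1 c2) s1 (m1 + m2) s3
| ExecIfT t c1 c2 s s' m :
    eval s t != 0 -> exec c1 s m s' -> exec (If t c1 c2) s (cost t + m).+1 s'
| ExecIfF t c1 c2 s s' m :
    eval s t = 0 -> exec c2 s m s' -> exec (If t c1 c2) s (cost t + m).+1 s'
| ExecWhileT t c s1 s2 s3 m1 m2 :
    eval s1 t != 0 -> exec c s1 m1 s2 -> exec (While t c) s2 m2 s3 ->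
    exec (While t c) s1 (cost t + m1 + m2).+1 s3
| ExecWhileF t c s : eval s t = 0 -> exec (While t c) s (cost t).+1 s.

(* The answer is left in register 0. *)
Definition decides_within (c : cmd) (s : store) (T : nat) (A : Prop) : Prop :=
  exists m s', [/\ exec c s m s', m <= T
    & (vars s' 0 = 1 /\ A) \/ (vars s' 0 = 0 /\ ~ A)].

End Machine.

Lemma exec_det w c s m1 s1 m2 s2 :
  exec w c s m1 s1 -> exec w c s m2 s2 -> m1 = m2 /\ s1 = s2.
Proof.
move=> H; elim: H m2 s2 => {c s m1 s1};
  intros;
  match goal with E : exec _ _ _ ?m _ |- _ = ?m /\ _ => inversion E; subst end;
  repeat match goal with
  | IH : forall m s, exec _ ?c ?s0 m s -> _, E : exec _ ?c ?s0 _ _ |- _ =>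
      case: (IH _ _ E) => ? ?; subst; clear E
  end; by [split | congruence |
    match goal with H : is_true (_ != 0), E : _ = 0 |- _ => by rewrite E in H end].
Qed.

(* The values of p and q are fixed-point numbers, with numerators over a common
   denominator den (den = 1 when they are integers).  The threshold r, in units
   of 1 / den, is the mixed number rint + rnum / rden; its size and that of den
   do not enter num_bits.  The digraph is an unordered list of its arcs. *)
Record esp_input (n k : nat) := EspInput {
  arcs : seq ('I_n * 'I_n);
  den : nat;
  pnum : 'I_n -> 'I_k -> nat;
  qnum : 'I_n -> nat;
  rint : int;
  rnum : nat;
  rden : nat }.

Definition encodes (R : realFieldType) n k (I : esp_input n k) (e : rel 'I_n)
    (p : 'I_n -> 'I_k -> R) (q : 'I_n -> R) (r : rat) : Prop :=
  [/\ uniq (arcs I) /\ (forall u v, ((u, v) \in arcs I) = e u v),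
      0 < den I,
      forall v i, p v i = ((pnum I v i)%:R / (den I)%:R)%R,
      forall v, q v = ((qnum I v)%:R / (den I)%:R)%R
    & rnum I < rden I /\
      (r * (den I)%:R = (rint I)%:~R + (rnum I)%:R / (rden I)%:R)%R].

Definition bits (x : nat) : nat := (trunc_log 2 x).+1.

(* the number M of the complexity bound *)
Definition num_bits n k (I : esp_input n k) : nat :=
  bits (maxn (\max_v qnum I v) (\max_v \max_i pnum I v i)).

Section Layout.
Variable w : nat.

(* the number of w-bit words that hold m > 0 bits *)
Definition nwords (m : nat) : nat := (m.-1 %/ w).+1.

(* the L low-order words of x, least significant first *)
Definition words (L x : nat) : seq nat :=
  mkseq (fun j => x %/ 2 ^ (w * j) %% 2 ^ w) L.

Definition number (x : nat) : seq nat := words (nwords (bits x)) x.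

(* p and q are tables of records of the same width L; the other numbers are
   written without leading zero words, their lengths being in array 0. *)
Definition input_arrays n k (I : esp_input n k) : seq (seq nat) :=
  let L := nwords (num_bits I) in
  let ri := number `|rint I| in
  let rn := number (rnum I) in
  let rd := number (rden I) in
  let dn := number (den I) in
  [:: [:: n; k; size (arcs I); L; nat_of_bool (rint I < 0)%R;
          size ri; size rn; size rd; size dn];
      [seq val a.1 | a <- arcs I];
      [seq val a.2 | a <- arcs I];
      flatten [seq words L (qnum I v) | v <- enum 'I_n];
      flatten [seq words L (pnum I v i) | v <- enum 'I_n, i <- enum 'I_k];
      ri; rn; rd; dn].

Definition input_size n k (I : esp_input n k) : nat :=
  sumn (map size (input_arrays I)).

(* Everything that is not input is zero. *)
Definition load n k (I : esp_input n k) : store :=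
  Store (fun=> 0) (fun a i => nth 0 (nth [::] (input_arrays I) a) i).

End Layout.

(* Every rational instance has an encoding. *)
Lemma encodes_ex (R : realFieldType) n k (e : rel 'I_n)
    (p : 'I_n -> 'I_k -> rat) (q : 'I_n -> rat) (r : rat) :
  (forall v i, 0 <= p v i)%R -> (forall v, 0 <= q v)%R ->
  exists I : esp_input n k,
    encodes I e (fun v i => ratr (p v i) : R)%R (fun v => ratr (q v))%R r.
Proof.
move=> p0 q0.
pose d x := `|denq x|%N.
have d_gt0 x : 0 < d x by rewrite absz_gt0 denq_neq0.
have fixP D (x : rat) : (0 <= x)%R -> 0 < D -> d x %| D ->
    (ratr x : R)%R = ((`|numq x| * (D %/ d x))%:R / D%:R)%R.
  move=> x0 D0 dD; have D1 : (D%:R != 0 :> R)%R by rewrite pnatr_eq0 -lt0n.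
  apply: (canRL (mulfK D1)); rewrite -[in LHS](divnK dD) !natrM.
  rewrite /ratr mulrCA mulrC; congr (_ * _)%R.
  have dxE : ((d x)%:R = (denq x)%:~R :> R)%R by rewrite -[denq x]absz_denq.
  rewrite dxE divfK ?intr_eq0 ?denq_neq0 //.
  by rewrite -[in LHS](gez0_abs (_ : 0 <= numq x)%R) ?numq_ge0.
pose D := (\prod_v \prod_i d (p v i)) * \prod_v d (q v).
have D0 : 0 < D.
  by rewrite muln_gt0 !prodn_gt0 // => v; rewrite prodn_gt0.
pose x : rat := (r * D%:R)%R.
exists (EspInput (enum [pred a : 'I_n * 'I_n | e a.1 a.2]) D
  (fun v i => `|numq (p v i)|%N * (D %/ d (p v i)))
  (fun v => `|numq (q v)|%N * (D %/ d (q v)))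
  (numq x %/ denq x)%Z `|(numq x %% denq x)%Z|%N (d x)).
split=> //=.
- by split=> [|u v]; rewrite ?enum_uniq // mem_enum inE.
- move=> v i; apply: fixP => //; apply: dvdn_mulr.
  by rewrite (bigD1 v) //= (bigD1 i) //= -mulnA dvdn_mulr.
- by move=> v; apply: fixP => //; rewrite dvdn_mull // (bigD1 v) //= dvdn_mulr.
have m0 : (0 <= numq x %% denq x)%Z%R by rewrite modz_ge0 ?denq_neq0.
split; first by rewrite -ltz_nat gez0_abs // absz_denq ltz_pmod.
have dxE : ((d x)%:R = (denq x)%:~R :> rat)%R by rewrite -[denq x]absz_denq.
have dn0 : ((denq x)%:~R != 0 :> rat)%R by rewrite intr_eq0 denq_neq0.
rewrite -/x dxE -[LHS]divq_num_den {1}(divz_eq (numq x) (denq x)).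
rewrite rmorphD rmorphM mulrDl mulfK //; congr (_ + _ / _)%R.
by rewrite -[in LHS](gez0_abs m0).
Qed.

(* Main.v *)
Require Import Defs.
From mathcomp Require Import all_boot all_order all_algebra perm zify.
Set Implicit Arguments.
Unset Strict Implicit.
Unset Printing Implicit Defensive.
Import Order.TTheory GRing.Theory Num.Theory.

(** On a directed path the transfer cost of a labelling is the sum of [q v] over
    the vertices [v] whose successor has another label, so a Viterbi recursion
    along the path applies.  After [t] vertices, entry [i] of the table [F] is
    the least cost of a labelling whose next vertex has label [i]; visiting [v]
    first adds [p v i] to each [F i] and then replaces [F i] by the minimum of
    [F i] and all [F j + q v].  The minimum may be taken in place: no entry falls
    below the least one, which is therefore unchanged.

    Costs are integers over the common denominator, hence the comparison with
    the threshold depends on its integer part [rint] only, and when [rint] has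
    more words than a table entry can have, it is decided by the length of
    [rint]. *)

(** * Program logic with step counts *)

Section Logic.
Variable w : nat.

Definition run c s T (Q : store -> Prop) :=
  exists m s', [/\ exec w c s m s', m <= T & Q s'].

(** Syntactic bounds on what a command may write. [exec_agree] turns them into frame conditions, so
    that postconditions and loop invariants only have to mention what changes. *)
Fixpoint mod_vars c : seq nat :=
  match c with
  | Skip | Put _ _ _ => [::]
  | Assign x _ => [:: x]
  | Seq c1 c2 | If _ c1 c2 => mod_vars c1 ++ mod_vars c2
  | While _ c1 => mod_vars c1
  end.

Fixpoint mod_arrs c : seq nat :=
  match c with
  | Skip | Assign _ _ => [::]
  | Put a _ _ => [:: a]
  | Seq c1 c2 | If _ c1 c2 => mod_arrs c1 ++ mod_arrs c2
  | While _ c1 => mod_arrs c1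
  end.

Definition agree (xs bs : seq nat) s s' :=
  (forall x, x \notin xs -> vars s' x = vars s x) /\
  (forall a, a \notin bs -> arrs s' a = arrs s a).

Lemma agree_trans xs bs s1 s2 s3 :
  agree xs bs s1 s2 -> agree xs bs s2 s3 -> agree xs bs s1 s3.
Proof. by case=> v a [v' a']; split=> x xn; rewrite ?v' ?a' ?v ?a. Qed.

Lemma sub_agree xs bs xs' bs' s s' :
  {subset xs <= xs'} -> {subset bs <= bs'} -> agree xs bs s s' ->
  agree xs' bs' s s'.
Proof.
move=> sx sb [v a]; split=> x; first by move/(contra (sx x))/v.
by move/(contra (sb x))/a.
Qed.

Lemma exec_agree c s m s' :
  exec w c s m s' -> agree (mod_vars c) (mod_arrs c) s s'.
Proof.
elim=> {c s m s'} /=.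
- by [].
- by move=> s x t; split=> // y; rewrite inE /= /upd => /negPf->.
- by move=> s a t1 t2; split=> // y; rewrite inE /= /upd => /negPf->.
- move=> c1 c2 s1 s2 s3 _ _ _ A1 _ A2; apply: agree_trans.
    by apply: sub_agree A1 => x xc; rewrite mem_cat xc.
  by apply: sub_agree A2 => x xc; rewrite mem_cat xc orbT.
- by move=> _ c1 c2 s s' _ _ _; apply: sub_agree => x xc; rewrite mem_cat xc.
- move=> _ c1 c2 s s' _ _ _; apply: sub_agree => x xc;
  by rewrite mem_cat xc orbT.
- by move=> _ c s1 s2 s3 _ _ _ _ A1 _; apply: agree_trans.
- by [].
Qed.

Lemma run_le c s T T' Q : T <= T' -> run c s T Q -> run c s T' Q.
Proof.
by move=> TT [m [s' [e mT q]]]; exists m, s'; split=> //; apply: leq_trans TT.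
Qed.

Lemma run_conseq c s T (P Q : store -> Prop) :
  run c s T P ->
  (forall s', agree (mod_vars c) (mod_arrs c) s s' -> P s' -> Q s') ->
  run c s T Q.
Proof.
case=> m [s' [e mT p]] PQ; exists m, s'; split=> //.
exact: PQ (exec_agree e) p.
Qed.

Lemma run_skip s (Q : store -> Prop) : Q s -> run Skip s 1 Q.
Proof. by move=> q; exists 1, s; split=> //; constructor. Qed.

Lemma run_assign x t s (Q : store -> Prop) :
  Q (set_var s x (eval w s t)) -> run (Assign x t) s (cost t).+1 Q.
Proof. by move=> q; do 2 eexists; split; [constructor | | exact: q]. Qed.

Lemma run_put a t1 t2 s (Q : store -> Prop) :
  Q (set_arr s a (eval w s t1) (eval w s t2)) ->
  run (Put a t1 t2) s (cost t1 + cost t2).+1 Q.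
Proof. by move=> q; do 2 eexists; split; [constructor | | exact: q]. Qed.

Lemma run_seq c1 c2 s T1 T2 (P Q : store -> Prop) :
  run c1 s T1 P ->
  (forall s1, agree (mod_vars c1) (mod_arrs c1) s s1 -> P s1 ->
     run c2 s1 T2 Q) ->
  run (Seq c1 c2) s (T1 + T2) Q.
Proof.
case=> m [s1 [e mT p]] /(_ s1 (exec_agree e) p)[m' [s2 [e' mT' q]]].
by exists (m + m'), s2; split; [apply: ExecSeq e' | apply: leq_add |].
Qed.

Lemma run_assign_seq x t c s T (Q : store -> Prop) :
  run c (set_var s x (eval w s t)) T Q ->
  run (Seq (Assign x t) c) s ((cost t).+1 + T) Q.
Proof.
move=> [m [s' [e mT q]]]; exists ((cost t).+1 + m), s'.
by split; rewrite ?leq_add2l //; apply: ExecSeq e; constructor.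
Qed.

Lemma run_put_seq a t1 t2 c s T (Q : store -> Prop) :
  run c (set_arr s a (eval w s t1) (eval w s t2)) T Q ->
  run (Seq (Put a t1 t2) c) s ((cost t1 + cost t2).+1 + T) Q.
Proof.
move=> [m [s' [e mT q]]]; exists ((cost t1 + cost t2).+1 + m), s'.
by split; rewrite ?leq_add2l //; apply: ExecSeq e; constructor.
Qed.

(** Charging both branches instead of the dearer one loses only a constant factor and keeps the
    bounds free of maxima. *)
Lemma run_if t c1 c2 s T1 T2 (Q : store -> Prop) :
  (eval w s t != 0 -> run c1 s T1 Q) -> (eval w s t = 0 -> run c2 s T2 Q) ->
  run (If t c1 c2) s (cost t + (T1 + T2)).+1 Q.
Proof.
move=> r1 r2; have [t0 | tn0] := eqVneq (eval w s t) 0.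
  case: (r2 t0) => [m [s' [e mT q]]]; exists (cost t + m).+1, s'; split=> //.
    exact: ExecIfF e.
  by rewrite ltnS leq_add2l (leq_trans mT) // leq_addl.
case: (r1 tn0) => [m [s' [e mT q]]]; exists (cost t + m).+1, s'; split=> //.
  exact: ExecIfT e.
by rewrite ltnS leq_add2l (leq_trans mT) // leq_addr.
Qed.

Definition For x b c :=
  Seq (Assign x (Const 0)) (While (Op Lt (Var x) (Var b))
    (Seq c (Assign x (Op Add (Var x) (Const 1))))).

(** Each round spends 8 steps on the test and the increment; the initial assignment and the failing
    test take the other 6. [Inv i] speaks of the store whose counter already holds [i], and the
    counter never wraps since it stays at most [N < 2 ^ w]. *)
Lemma run_for x b c s N T (Inv : nat -> store -> Prop) :
  vars s b = N -> N < 2 ^ w -> x != b ->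
  x \notin mod_vars c -> b \notin mod_vars c ->
  Inv 0 (set_var s x 0) ->
  (forall i s1, i < N -> agree (x :: mod_vars c) (mod_arrs c) s s1 ->
     vars s1 x = i -> Inv i s1 ->
     run c s1 T (fun s2 => Inv i.+1 (set_var s2 x i.+1))) ->
  run (For x b c) s (N * (T + 8) + 6) (Inv N).
Proof.
move=> sb Nw xb xc bc I0 step.
(* Induction on the number [d] of rounds still to come. *)
have loop d : forall i s1, i + d = N ->
    agree (x :: mod_vars c) (mod_arrs c) s s1 -> vars s1 x = i -> Inv i s1 ->
    run (While (Op Lt (Var x) (Var b))
      (Seq c (Assign x (Op Add (Var x) (Const 1))))) s1 (d * (T + 8) + 4) (Inv N).
  have bV s1 : agree (x :: mod_vars c) (mod_arrs c) s s1 -> vars s1 b = N.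
    by case=> /(_ b); rewrite inE negb_or bc eq_sym xb sb => /(_ isT).
  elim: d => [|d IH] i s1 iN As1 s1x Is1.
    rewrite addn0 in iN; exists 4, s1; split; rewrite -?iN //.
    by apply: ExecWhileF; rewrite /= s1x bV // iN ltnn.
  have ltiN : i < N by rewrite -iN addnS ltnS leq_addr.
  case: (step _ _ ltiN As1 s1x Is1) => m [s2 [e mT Is2]].
  have [vs2 as2] := exec_agree e.
  have s2x : vars s2 x = i by rewrite vs2.
  have inc : (i + 1 %% 2 ^ w) %% 2 ^ w = i.+1.
    by rewrite modnDmr addn1 modn_small // (leq_ltn_trans ltiN).
  have As2 : agree (x :: mod_vars c) (mod_arrs c) s (set_var s2 x i.+1).
    apply: agree_trans As1 _; split=> y; last exact: as2.
    by rewrite inE negb_or /= /upd => /andP[/negPf-> /vs2].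
  have [||m' [s3 [e' mT' Is3]]] := IH i.+1 _ _ As2 _ Is2.
  - by rewrite addSnnS.
  - by rewrite /= /upd eqxx.
  exists (3 + (m + 4) + m').+1, s3; split=> //; last first.
    by move: mT mT'; rewrite mulSn; lia.
  apply: (ExecWhileT (s2 := set_var s2 x i.+1)) => //=.
    by rewrite s1x bV // ltiN.
  have := @ExecAssign w s2 x (Op Add (Var x) (Const 1)).
  by rewrite /= s2x inc; apply: ExecSeq.
have [||m [s2 [e mT q]]] := loop N 0 (set_var s x 0) (add0n _) _ _ I0.
- by split=> // y; rewrite inE negb_or /= /upd => /andP[/negPf->].
- by rewrite /= /upd eqxx.
exists (2 + m), s2; split=> //; last by lia.
apply: ExecSeq e; have := @ExecAssign w s x (Const 0).
by rewrite /= mod0n.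
Qed.

End Logic.

(** * Registers, and programs for multi-word arithmetic *)

Local Notation "c1 ;; c2" := (Seq c1 c2) (at level 90, right associativity).
Local Notation "x ::= t" := (Assign x t) (at level 80).

Local Notation rans := 0 (only parsing).
Local Notation rn := 1 (only parsing).
Local Notation rk := 2 (only parsing).
Local Notation rL := 3 (only parsing).
Local Notation rm := 4 (only parsing).
Local Notation rt := 5 (only parsing).
Local Notation rcur := 6 (only parsing).
Local Notation ri := 7 (only parsing).
Local Notation rj := 8 (only parsing).
Local Notation rl := 9 (only parsing).
Local Notation rc := 10 (only parsing).
Local Notation rx := 11 (only parsing).
Local Notation rs := 12 (only parsing).
Local Notation ru := 13 (only parsing).
Local Notation rlt := 14 (only parsing).
Local Notation rtop := 15 (only parsing).
Local Notation ra := 16 (only parsing).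
Local Notation rb := 17 (only parsing).
Local Notation rd := 18 (only parsing).

(** Schoolbook addition of the [L]-word numbers at offsets [ra] and [rb]. The machine has no carry
    flag: a wrapped sum is recognised by being smaller than a summand. *)
Definition add_words d a b :=
  rc ::= Const 0 ;;
  For rl rL (
    rx ::= Get a (Op Add (Var ra) (Var rl)) ;;
    rs ::= Op Add (Var rx) (Get b (Op Add (Var rb) (Var rl))) ;;
    ru ::= Op Add (Var rs) (Var rc) ;;
    Put d (Op Add (Var rd) (Var rl)) (Var ru) ;;
    rc ::= Op Add (Op Lt (Var rs) (Var rx)) (Op Lt (Var ru) (Var rs))).

(** The scan goes from the least significant word upwards, so each word overrides the verdict so far
    unless the two words are equal. *)
Definition less_words a b :=
  rlt ::= Const 0 ;;
  For rl rL (
    rx ::= Get a (Op Add (Var ra) (Var rl)) ;;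
    rs ::= Get b (Op Add (Var rb) (Var rl)) ;;
    rlt ::= Op Add (Op Lt (Var rx) (Var rs))
              (Op Mul (Op Eq (Var rx) (Var rs)) (Var rlt))).

#[local] Arguments upd T g x y z /.

(** * Correctness of multi-word addition and comparison *)

Section Words.
Variable w : nat.
Hypothesis w_gt0 : 0 < w.
Local Notation B := (2 ^ w).

Lemma base_gt1 : 1 < B. Proof. by rewrite -{1}(expn0 2) ltn_exp2l. Qed.
Lemma base_gt0 : 0 < B. Proof. by rewrite expn_gt0. Qed.
Hint Resolve base_gt1 base_gt0 : core.

Definition val_words L (d : nat -> nat) := \sum_(l < L) d l * B ^ l.

Lemma val_words0 d : val_words 0 d = 0. Proof. exact: big_ord0. Qed.

Lemma val_wordsS L d : val_words L.+1 d = val_words L d + d L * B ^ L.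
Proof. exact: big_ord_recr. Qed.

Lemma eq_val_words L d d' :
  (forall l, l < L -> d l = d' l) -> val_words L d = val_words L d'.
Proof. by move=> dd; apply: eq_bigr => l _; rewrite dd. Qed.

Lemma val_words_lt L d : (forall l, l < L -> d l < B) -> val_words L d < B ^ L.
Proof.
elim: L => [|L IH] dB; first by rewrite val_words0.
rewrite val_wordsS expnS.
have := IH (fun l lL => dB l (ltnW lL)); have := dB L (ltnSn L); nia.
Qed.

(** Cutting [x] at [B ^ L] leaves a quotient whose residue modulo [B] is the next digit. This is how
    the numbers stored in the input are read back. *)
Lemma val_words_digits L x :
  val_words L (fun l => x %/ B ^ l %% B) = x %% B ^ L.
Proof.
elim: L => [|L IH]; first by rewrite val_words0 modn1.
rewrite val_wordsS IH expnSr.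
have P0 : 0 < B ^ L by rewrite expn_gt0 base_gt0.
set r := x %% B ^ L; set q := x %/ B ^ L.
have xE : x = q %/ B * (B ^ L * B) + (r + q %% B * B ^ L).
  rewrite [LHS](divn_eq x (B ^ L)) -/q -/r {1}(divn_eq q B).
  by rewrite mulnDl -mulnA [B * _]mulnC -addnA [r + _]addnC.
rewrite [in RHS]xE modnMDl [in RHS]modn_small //.
have zB := ltn_pmod q base_gt0; have rP : r < B ^ L by rewrite ltn_pmod.
rewrite [ltnRHS]mulnC; apply: (leq_trans (n := (q %% B).+1 * B ^ L)).
  by rewrite mulSn ltn_add2r.
by rewrite leq_mul2r zB orbT.
Qed.

(** At most one of the two additions wraps: if [x + y] does, then [s <= B - 2] and adding a carry of
    at most 1 stays below [B]. Hence the outgoing carry is again at most 1. *)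
Lemma add_digit x y c (s := (x + y) %% B) (u := (s + c) %% B)
    (c' := ((s < x) + (u < s)) %% B) :
  x < B -> y < B -> c <= 1 ->
  [/\ u < B, c' <= 1 & x + y + c = u + c' * B].
Proof.
move=> xB yB c1.
have B1 := base_gt1.
have red z : z < B + B -> z %% B = if z < B then z else z - B.
  move=> zB; case: ltnP => [/modn_small-> // | Bz].
  by rewrite -{1}(subnK Bz) modnDr modn_small //; lia.
have sE := red (x + y) _.
have uE := red (s + c) _.
have sB : s < B by rewrite ltn_pmod.
have uB : u < B by rewrite ltn_pmod.
have {}sE : s = if x + y < B then x + y else x + y - B by apply: sE; lia.
have {}uE : u = if s + c < B then s + c else s + c - B by apply: uE; lia.
have c'E : c' = (s < x) + (u < s).
  by rewrite /c' modn_small //; move: sE uE; do 2 case: ifP; lia.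
rewrite c'E; move: sE uE; clearbody s u; clear c' c'E red.
by do 2 case: ifP; split=> //; try lia; nia.
Qed.

(** The leading digits decide unless they are equal, because the lower parts stay below the weight
    [b]. It serves for each round of [less_words] and once more for the separate top word. *)
Lemma less_digit b x y X Y : x < b -> y < b ->
  ((X < Y) + ((X == Y) * (x < y)) %% B) %% B = (x + X * b < y + Y * b).
Proof.
move=> xb yb; have B1 := base_gt1.
rewrite [X in (_ + X) %% B]modn_small; last by case: eqP; case: ltnP; lia.
rewrite modn_small; last by case: ltngtP; case: ltnP; lia.
have [XY | YX | ->] := ltngtP X Y; rewrite ?mul0n ?mul1n ?ltn_add2r //=.
  have : X.+1 * b <= Y * b by rewrite leq_mul2r XY orbT.
  by rewrite mulSn => xyB; rewrite (_ : _ < _) //; lia.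
have : Y.+1 * b <= X * b by rewrite leq_mul2r YX orbT.
by rewrite mulSn => xyB; rewrite ltnNge (_ : _ <= _) //; lia.
Qed.

(** Addition also serves to write into the table, whose other slots must survive; this is the
    purpose of the last clause. *)
Lemma run_add d a b s L :
  d != a -> d != b -> vars s rL = L -> L < B ->
  vars s ra + L <= B -> vars s rb + L <= B -> vars s rd + L <= B ->
  (forall m, arrs s a m < B) -> (forall m, arrs s b m < B) ->
  run w (add_words d a b) s (L * 37 + 8) (fun s' =>
    [/\ (forall m, arrs s d m < B) -> forall m, arrs s' d m < B,
     vars s' rc <= 1,
     val_words L (fun l => arrs s' d (vars s rd + l)) + vars s' rc * B ^ L =
     val_words L (fun l => arrs s a (vars s ra + l)) +
     val_words L (fun l => arrs s b (vars s rb + l)) &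
     forall m, ~~ (vars s rd <= m < vars s rd + L) ->
       arrs s' d m = arrs s d m]).
Proof.
move=> da db sL LB aB bB dB sa sb.
apply: (@run_le _ _ _ (2 + (L * (29 + 8) + 6))); first by lia.
apply: run_assign_seq; rewrite /= mod0n; set s0 := set_var _ _ _.
apply: (run_for (Inv := fun i s' =>
  [/\ (forall m, arrs s d m < B) -> forall m, arrs s' d m < B,
     vars s' rc <= 1,
     val_words i (fun l => arrs s' d (vars s rd + l)) + vars s' rc * B ^ i =
     val_words i (fun l => arrs s a (vars s ra + l)) +
     val_words i (fun l => arrs s b (vars s rb + l)) &
     forall m, ~~ (vars s rd <= m < vars s rd + i) ->
       arrs s' d m = arrs s d m])) => //.
  by split=> //=; rewrite !val_words0.
move=> i s1 iL [/= vV vA] s1l [I1 I2 I3 I4].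
eapply run_le; last first.
  do 3 apply: run_assign_seq; apply: run_put_seq; apply: run_assign => /=.
  rewrite eqxx s1l (vV 16) // (vV 17) // (vV 18) //=.
  rewrite (vA a) ?inE 1?eq_sym // (vA b) ?inE 1?eq_sym //.
  rewrite ![(_ + i) %% B]modn_small; try by lia.
  have [|||] := @add_digit (arrs s a (vars s 16 + i))
    (arrs s b (vars s 17 + i)) (vars s1 10) => //.
  set x := arrs s a _; set y := arrs s b _; set u := (_ %% B).
  set c' := ((_ %% B < _) + _) %% B => uB c1 E.
  split=> //.
  - by move=> bd m /=; case: ifP => // _; apply: I1.
  - rewrite !val_wordsS /= eqxx -/x -/y.
    rewrite (@eq_val_words _ _ (fun l => arrs s1 d (vars s rd + l))); last first.
      by move=> l li; rewrite eqn_add2l ltn_eqF.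
    rewrite expnS addnACA -I3 mulnA -addnA -!mulnDl -E; lia.
  - move=> m mi /=.
    rewrite ifN; last by apply: contra mi => /eqP->; lia.
    by apply: I4; apply: contra mi => /andP[-> mi] /=; lia.
by [].
Qed.

Lemma run_less a b s L :
  vars s rL = L -> L < B ->
  vars s ra + L <= B -> vars s rb + L <= B ->
  (forall m, arrs s a m < B) -> (forall m, arrs s b m < B) ->
  run w (less_words a b) s (L * 28 + 8) (fun s' =>
    vars s' rlt = (val_words L (fun l => arrs s a (vars s ra + l)) <
                   val_words L (fun l => arrs s b (vars s rb + l)))).
Proof.
move=> sL LB aB bB sa sb.
apply: (@run_le _ _ _ (2 + (L * (20 + 8) + 6))); first by lia.
apply: run_assign_seq; rewrite /= mod0n; set s0 := set_var _ _ _.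
apply: (run_for (Inv := fun i s' =>
    vars s' rlt = (val_words i (fun l => arrs s a (vars s ra + l)) <
                   val_words i (fun l => arrs s b (vars s rb + l))))) => //.
  by rewrite !val_words0.
move=> i s1 iL [/= vV vA] s1l I1.
eapply run_le; last first.
  do 2 apply: run_assign_seq; apply: run_assign => /=.
  rewrite s1l (vV 16) // (vV 17) //= !vA //=.
  rewrite ![(_ + i) %% B]modn_small; try by lia.
  rewrite I1 !val_wordsS.
  have la : val_words i (fun l => arrs s a (vars s ra + l)) < B ^ i.
    by apply: val_words_lt.
  have lb : val_words i (fun l => arrs s b (vars s rb + l)) < B ^ i.
    by apply: val_words_lt.
  set x := arrs s a _; set y := arrs s b _.
  move: la lb; set X := val_words _ _; set Y := val_words _ _ => la lb.
  by apply: less_digit.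
by [].
Qed.

End Words.

(** * The recursion on tables of costs, independently of the machine *)

Section Labellings.
Variables (k : nat) (P : nat -> nat -> nat) (Q : nat -> nat).

Definition labelling (f : nat -> nat) := forall t, f t < k.

(* The transfer from position t.-1 to position t is included. *)
Definition path_cost t (f : nat -> nat) :=
  \sum_(u < t) (P u (f u) + (f u != f u.+1) * Q u).

(** Together with [minorant] this makes [F i] the least cost of a labelling with label [i] at
    position [t]. The halves are kept apart because every single in-place update preserves
    [attained], whereas [minorant] is recovered only after all updates. *)
Definition attained t (F : nat -> nat) := forall i, i < k ->
  exists f, [/\ labelling f, f t = i & path_cost t f <= F i].

Definition minorant t (F : nat -> nat) := forall f, labelling f ->
  F (f t) <= path_cost t f.

Lemma path_costS t f :
  path_cost t.+1 f = path_cost t f + (P t (f t) + (f t != f t.+1) * Q t).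
Proof. exact: big_ord_recr. Qed.

Lemma path_cost_upd t f i : path_cost t.+1 (upd f t.+1 i) =
  path_cost t f + (P t (f t) + (f t != i) * Q t).
Proof.
rewrite path_costS /= eqxx ltn_eqF //; congr (_ + _).
apply: eq_bigr => u _ /=; have ut := ltn_ord u.
by rewrite (ltn_eqF (ltnW ut : u < t.+1)) eqSS (ltn_eqF ut).
Qed.

Lemma labelling_upd f t i : labelling f -> i < k -> labelling (upd f t i).
Proof. by move=> fk ik u /=; case: ifP. Qed.

Lemma attained0 F : attained 0 F.
Proof. by move=> i ik; exists (fun=> i); split=> //; rewrite /path_cost big_ord0. Qed.

(** Repeating the label of position [t] at position [t.+1] costs no transfer. *)
Lemma attained_add t F : attained t F -> attained t.+1 (fun i => F i + P t i).
Proof.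
move=> aF i ik; have [f [fk fi cf]] := aF i ik.
exists (upd f t.+1 i); split; [exact: labelling_upd | by rewrite /= eqxx |].
by rewrite path_cost_upd fi eqxx addn0 leq_add2r.
Qed.

(** Changing only the label at position [t.+1] raises the cost by at most [Q t], whatever the label
    at [t] is. The entry [F j] may therefore have been relaxed already, which makes the in-place
    update sound. *)
Lemma attained_relax t F i j : i < k -> j < k ->
  attained t.+1 F -> attained t.+1 (upd F i (F j + Q t)).
Proof.
move=> ik jk aF x xk; have [-> | xi] := eqVneq x i; last first.
  by rewrite /= (negPf xi); apply: aF.
have [f [fk fi cf]] := aF j jk.
exists (upd f t.+1 i); split; [exact: labelling_upd | by rewrite /= eqxx |].
rewrite path_cost_upd /= eqxx; move: cf; rewrite path_costS.
by case: (_ != i); lia.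
Qed.

(** A labelling either keeps its label from [t] to [t.+1] or pays [Q t]; the two bounds on [G]
    answer these two cases. *)
Lemma minorant_relax t F G : minorant t F ->
  (forall i, i < k -> G i <= F i + P t i) ->
  (forall i j, i < k -> j < k -> G i <= F j + P t j + Q t) ->
  minorant t.+1 G.
Proof.
move=> mF G1 G2 f fk; rewrite path_costS; have := mF f fk.
have [E | _] := eqVneq (f t) (f t.+1).
  by have := G1 _ (fk t); rewrite -E; lia.
by have := G2 _ _ (fk t.+1) (fk t); lia.
Qed.

End Labellings.

(** * Arrays, and programs operating on the table *)

Local Notation aH := 0 (only parsing).
Local Notation asrc := 1 (only parsing).
Local Notation adst := 2 (only parsing).
Local Notation aq := 3 (only parsing).
Local Notation ap := 4 (only parsing).
Local Notation ar := 5 (only parsing).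
Local Notation asucc := 9 (only parsing).
Local Notation aD := 10 (only parsing).
Local Notation atop := 11 (only parsing).
Local Notation aT := 12 (only parsing).
Local Notation aZ := 13 (only parsing).

(* A table entry has L low-order words, stored contiguously in aD, and one more
   word in atop: a single array of stride L + 1 would need k * (L + 1) words,
   which may exceed 2 ^ w when n = 1. *)
Definition sum_slot b :=
  ra ::= Op Mul (Var rj) (Var rL) ;;
  rd ::= Const 0 ;;
  add_words aT aD b ;;
  rtop ::= Op Add (Get atop (Var rj)) (Var rc).

(** Copying is addition of the all-zero array [aZ], so that [run_add] covers it. *)
Definition copy_slot :=
  ra ::= Const 0 ;;
  rb ::= Const 0 ;;
  rd ::= Op Mul (Var ri) (Var rL) ;;
  add_words aD aT aZ ;;
  Put atop (Var ri) (Var rtop).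

(** The top word is passed as an expression: it lies in [rtop] for a new sum, but in cell [L] of
    [ar] for the threshold. *)
Definition less_slot a (top : expr) :=
  ra ::= Const 0 ;;
  rb ::= Op Mul (Var ri) (Var rL) ;;
  less_words a aD ;;
  rlt ::= Op Add (Op Lt top (Get atop (Var ri)))
            (Op Mul (Op Eq top (Get atop (Var ri))) (Var rlt)).

Definition add_p :=
  rb ::= Op Mul (Op Add (Op Mul (Var rcur) (Var rk)) (Var rj)) (Var rL) ;;
  sum_slot ap ;;
  ri ::= Var rj ;;
  copy_slot.

Definition relax :=
  rb ::= Op Mul (Var rcur) (Var rL) ;;
  sum_slot aq ;;
  less_slot aT (Var rtop) ;;
  If (Var rlt) copy_slot Skip.

Definition visit :=
  For rj rk add_p ;;
  For ri rk (For rj rk relax) ;;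
  rcur ::= Get asucc (Var rcur).

(** Header cells 4 and 5 hold the sign of [rint] and its number of words. A negative threshold
    leaves the initial answer 0, since costs are nonnegative; one of more than [L + 1] words exceeds
    every table entry. *)
Definition finish :=
  If (Get aH (Const 4)) Skip
    (If (Op Lt (Op Add (Var rL) (Const 1)) (Get aH (Const 5)))
       (rans ::= Const 1)
       (For ri rk
         (less_slot ar (Get ar (Var rL)) ;;
          If (Var rlt) Skip (rans ::= Const 1)))).

(** * Correctness of the table programs *)

Section Slots.
Variable w : nat.
Hypothesis w_gt0 : 0 < w.
Local Notation B := (2 ^ w).
Variables (n k L : nat) (s0 : store).
Hypotheses (n_gt0 : 0 < n) (k_gt0 : 0 < k) (L_gt0 : 0 < L).
Hypothesis small : n * k * L + n * L < B.
Hypothesis digits0 : forall a m, a \in [:: aq; ap; ar] -> arrs s0 a m < B.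
Hypothesis zero0 : forall m, arrs s0 aZ m = 0.

Definition low s a o := val_words w L (fun l => arrs s a (o + l)).

(** [s0] is the store before the traversal; only the three work arrays may depart from it. *)
Definition good s := [/\ vars s rn = n, vars s rk = k, vars s rL = L &
  forall a, a \notin [:: aD; atop; aT] -> arrs s a = arrs s0 a].

Definition holds s (F : nat -> nat) :=
  [/\ forall m, arrs s aD m < B, forall m, arrs s aT m < B &
   forall i, i < k -> low s aD (i * L) + arrs s atop i * B ^ L = F i].

Lemma good_agree xs bs s s' : agree xs bs s s' ->
  [&& rn \notin xs, rk \notin xs & rL \notin xs] ->
  all (mem [:: aD; atop; aT]) bs -> good s -> good s'.
Proof.
move=> [v a] /and3P[x1 x2 x3] sb [g1 g2 g3 g4]; split; rewrite ?v //.
by move=> b bn; rewrite a ?g4 //; apply: contra bn => /(allP sb).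
Qed.

(** The table has [k * L] low-order words, no more than the input table of [p], so its addresses fit
    in a word. *)
Lemma slot_end i : i < k -> i * L + L <= B.
Proof.
move=> ik; have : i.+1 * L <= k * L by rewrite leq_mul2r ik orbT.
have : 1 * (k * L) <= n * (k * L) by rewrite leq_mul2r n_gt0 orbT.
by rewrite mulSn mulnA; lia.
Qed.

Lemma L_lt : L < B.
Proof. by have := slot_end k_gt0; nia. Qed.

Lemma k_lt : k < B.
Proof. nia. Qed.

Lemma n_lt : n < B.
Proof.
have : n <= n * L by rewrite leq_pmulr.
have : 0 < n * k * L by rewrite !muln_gt0 n_gt0 k_gt0.
lia.
Qed.

Lemma mod_offset i : i < k -> i * L %% B = i * L.
Proof. by move=> /slot_end iB; rewrite modn_small //; lia. Qed.

Lemma run_sum s b j F : good s -> holds s F -> b != aT ->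
  (forall m, arrs s b m < B) -> vars s rj = j -> j < k ->
  vars s rb + L <= B -> F j + low s b (vars s rb) < B ^ L.+1 ->
  run w (sum_slot b) s (37 * L + 30) (fun s' => holds s' F /\
    low s' aT 0 + vars s' rtop * B ^ L = F j + low s b (vars s rb)).
Proof.
move=> [_ _ sL gA] [D1 D2 D3] bT bB sj jk rB FB.
have LB := L_lt; have jB := slot_end jk.
eapply run_le; last first.
  do 2 apply: run_assign_seq; rewrite /= mod0n sj sL mod_offset //.
  apply: run_seq.
    by apply: (@run_add _ w_gt0 _ _ _ _ L) => //=; [rewrite eq_sym | apply: ltnW].
  move=> s1 [/= vV vA] [E1 E2 E3 _]; apply: run_assign => /=.
  rewrite (vV 8) // (vA 11) //= sj.
  have H : val_words w L (fun l => arrs s1 12 (0 + l)) +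
      (arrs s 11 j + vars s1 10) * B ^ L = F j + low s b (vars s 17).
    by rewrite mulnDl -(D3 j) //; move: E3; rewrite /low; lia.
  split; last by rewrite modn_small //; move: FB; rewrite -H expnS; nia.
  split=> [m|m|i ik] /=; [by rewrite vA | exact: E1 |].
  by rewrite vA // -D3 // /low /= vA.
by rewrite /=; lia.
Qed.

Lemma run_copy s i F X : good s -> holds s F -> vars s ri = i -> i < k ->
  low s aT 0 + vars s rtop * B ^ L = X ->
  run w copy_slot s (37 * L + 30) (fun s' => holds s' (upd F i X)).
Proof.
move=> [_ _ sL gA] [D1 D2 D3] si ik TX.
have LB := L_lt; have iB := slot_end ik.
eapply run_le; last first.
  do 3 apply: run_assign_seq; rewrite /= mod0n si sL mod_offset //.
  apply: run_seq.
    apply: (@run_add _ w_gt0 _ _ _ _ L) => //=; try exact: ltnW.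
    by move=> m; rewrite gA // zero0 base_gt0.
  move=> s1 [/= vV vA] [E1 E2 E3 E4]; apply: run_put => /=.
  rewrite (vV 7) // (vV 15) //= si.
  split=> [m|m|x xk] /=; [exact: E1 | by rewrite vA |].
  have [-> | xi] := eqVneq x i.
    rewrite -TX /low /=; congr (_ + _).
    have T_lt : val_words w L (fun l => arrs s 12 (0 + l)) < B ^ L.
      by apply: val_words_lt.
    have Z0 : val_words w L (fun l => arrs s 13 (0 + l)) = 0.
      by rewrite /val_words big1 // => l _; rewrite gA // zero0.
    (* Adding zero cannot produce a carry, because the copied number is below [B ^ L]. *)
    move: E3 E2; rewrite Z0; case: (vars s1 10) => [|[|//]]; first by lia.
    by move: T_lt; lia.
  rewrite -D3 // vA // /low; congr (_ + _); apply: eq_val_words => l lL /=.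
  apply: E4; apply: contra xi => /andP[E4 E5].
  (* Slots of distinct indices are disjoint: a common address rules out both [x < i] and [i < x]. *)
  rewrite eqn_leq -[x <= i]ltnS -[i <= x]ltnS.
  have := leq_mul2r L x.+1 i; have := leq_mul2r L i.+1 x.
  by rewrite !mulSn !ltnS; case: ltngtP; lia.
by rewrite /=; lia.
Qed.

(** The expression [t] is evaluated after the loop over the words, so its value has to survive
    changes of the scratch registers. The cost bound 2 admits a register or an array cell indexed by
    one. *)
Lemma run_less_slot s i F a t X : good s -> holds s F ->
  (forall m, arrs s a m < B) -> vars s ri = i -> i < k ->
  (forall s', agree [:: ra; rb; rl; rx; rs; rlt] [::] s s' -> eval w s' t = X) ->
  cost t <= 2 ->
  run w (less_slot a t) s (28 * L + 40) (fun s' =>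
    vars s' rlt = (low s a 0 + X * B ^ L < F i)).
Proof.
move=> [_ _ sL gA] [D1 D2 D3] sa si ik tX ct.
have LB := L_lt; have iB := slot_end ik.
eapply run_le; last first.
  do 2 apply: run_assign_seq; rewrite /= mod0n si sL mod_offset //.
  apply: run_seq.
    by apply: (@run_less _ w_gt0 _ _ _ L) => //=; apply: ltnW.
  move=> s1 [/= vV vA] E1; apply: run_assign => /=.
  rewrite tX; last first.
    split=> x xn; last by rewrite vA.
    move: xn; rewrite !inE !negb_or => xn; rewrite vV ?inE ?negb_or.
      by have [/negPf-> /andP[/negPf-> _]] := andP xn.
    by have [_ /andP[_ /and4P[-> -> -> ->]]] := andP xn.
  rewrite (vV 7) // vA //= si E1 -D3 // /low.
  set x := val_words _ _ _; set y := val_words _ _ _.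
  have xL : x < B ^ L by apply: val_words_lt.
  have yL : y < B ^ L by apply: val_words_lt.
  by apply: less_digit.
by rewrite /=; lia.
Qed.

Definition mem_q v := low s0 aq (v * L).
Definition mem_p v i := low s0 ap ((v * k + i) * L).

Lemma q_end v : v < n -> v * L + L <= B.
Proof.
move=> vn; have : v.+1 * L <= n * L by rewrite leq_mul2r vn orbT.
by rewrite mulSn; lia.
Qed.

Lemma p_end v i : v < n -> i < k -> (v * k + i) * L + L <= B.
Proof.
move=> vn ik; have vk : v.+1 * k <= n * k by rewrite leq_mul2r vn orbT.
have : (v * k + i).+1 * L <= n * k * L.
  by rewrite leq_mul2r (leq_trans _ vk) ?orbT // mulSn; lia.
by rewrite mulSn; lia.
Qed.

Lemma run_add_p s v j F : good s -> holds s F -> vars s rcur = v -> v < n ->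
  vars s rj = j -> j < k -> F j + mem_p v j < B ^ L.+1 ->
  run w add_p s (74 * L + 80) (fun s' => holds s' (upd F j (F j + mem_p v j))).
Proof.
move=> gs hs sv vn sj jk FB; have [g1 g2 g3 g4] := gs.
have pB := p_end vn jk.
eapply run_le; last first.
  apply: run_assign_seq; rewrite /= sv sj g2 g3.
  rewrite modnDml modnMml modn_small; last by lia.
  apply: run_seq.
    apply: (@run_sum _ _ j F) => //=; first by move=> m; rewrite g4 // digits0.
    by rewrite /low /= g4.
  move=> s1 ag1 [h1 T1]; apply: run_assign_seq.
  have g1' : good s1.
    by apply: good_agree ag1 _ _ gs .
  have [v1 _] := ag1.
  apply: (run_copy (F := F)) => //=.
    by rewrite v1 //= sj.
  by move: T1; rewrite /mem_p /low /= g4.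
by rewrite /=; lia.
Qed.

Lemma run_relax s v i j F : good s -> holds s F -> vars s rcur = v -> v < n ->
  vars s ri = i -> i < k -> vars s rj = j -> j < k ->
  F j + mem_q v < B ^ L.+1 ->
  run w relax s (102 * L + 120) (fun s' =>
    holds s' (if F j + mem_q v < F i then upd F i (F j + mem_q v) else F)).
Proof.
move=> gs hs sv vn si ik sj jk FB; have [g1 g2 g3 g4] := gs.
have qB := q_end vn.
eapply run_le; last first.
  apply: run_assign_seq; rewrite /= sv g3 modn_small; last by lia.
  apply: run_seq.
    apply: (@run_sum _ _ j F) => //=; first by move=> m; rewrite g4 // digits0.
    by rewrite /low /= g4.
  move=> s1 ag1; rewrite /low /= g4 // -/(low s0 aq (v * L)) -/(mem_q v) => -[h1 T1].
  have g1' : good s1.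
    by apply: good_agree ag1 _ _ gs .
  have [v1 _] := ag1; have [_ T1B _] := h1.
  have s1i : vars s1 ri = i by rewrite v1 //= si.
  apply: run_seq.
    apply: (@run_less_slot s1 i F aT (Var rtop) (vars s1 rtop)) => //.
    by move=> s' [vV _] /=; rewrite vV.
  move=> s2 ag2; rewrite T1 => lt2.
  have g2' : good s2 by apply: good_agree ag2 _ _ g1'.
  have [v2 a2] := ag2.
  have h2 : holds s2 F.
    case: h1 => h11 h12 h13.
    by split=> [m|m|x xk]; rewrite /low /= !a2 //; apply: h13.
  apply: run_if; rewrite /= lt2; last by case: ifP => // _ _; apply: run_skip.
  case: ifP => // _ _; apply: (run_copy (F := F)) => //.
    by rewrite v2.
  by rewrite /low !a2 // v2.
by rewrite /=; lia.
Qed.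

Lemma eq_holds s F G : (forall i, i < k -> F i = G i) -> holds s F -> holds s G.
Proof. by move=> FG [h1 h2 h3]; split=> // i ik; rewrite h3 ?FG. Qed.

Definition threshold := low s0 ar 0 + arrs s0 ar L * B ^ L.

Lemma run_finish s F : good s -> holds s F -> vars s rans = 0 -> 5 < B ->
  run w finish s (100 * (k * L.+1) + 30) (fun s' => vars s' rans =
    (if arrs s0 aH 4 != 0 then false else if L.+1 < arrs s0 aH 5 then true
     else has (fun i => F i <= threshold) (iota 0 k))).
Proof.
move=> gs hs s00 B5; have [g1 g2 g3 g4] := gs.
have small5 i : i < 6 -> i %% B = i by move=> i6; rewrite modn_small //; lia.
have L1 : L + 1 < B.
  by have := L_lt; have := n_lt; have := slot_end k_gt0; nia.
eapply run_le; last first.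
  apply: run_if => /=; rewrite small5 // g4 //.
    by move=> ->; apply: run_skip.
  move=> ->; rewrite eqxx; apply: run_if => /=.
    rewrite (small5 1) // (small5 5) // g3 g4 // modn_small // addn1 => c.
    apply: run_assign => /=.
    by rewrite small5 //; case: ltnP c.
  rewrite (small5 1) // (small5 5) // g3 g4 // modn_small // addn1 => c.
  rewrite (_ : _ < _ = false); last by case: ltnP c.
  apply: (run_for (Inv := fun i s' =>
    vars s' rans = has (fun i => F i <= threshold) (iota 0 i))) => //.
    exact: k_lt.
  move=> i s1 ik ag1 s1i r1; have [v1 a1] := ag1.
  have g1' : good s1 by apply: good_agree ag1 _ _ gs.
  have [_ _ g13 g14] := g1'.
  have h1 : holds s1 F.
    by case: hs => h1 h2 h3; split=> [m|m|x xk]; rewrite /low !a1 //; apply: h3.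
  apply: run_seq.
    apply: (@run_less_slot s1 i F ar (Get ar (Var rL)) (arrs s0 ar L)) => //.
      by move=> m; rewrite g14 // digits0.
    by move=> s' [vV aV] /=; rewrite vV // g13 aV // g14.
  move=> s2 [v2 a2] lt2.
  have E : has (fun i => F i <= threshold) (iota 0 i.+1) =
      has (fun i => F i <= threshold) (iota 0 i) || (F i <= threshold).
    by rewrite -addn1 iotaD has_cat /= orbF.
  have ltE : vars s2 rlt = (threshold < F i) by rewrite lt2 /low g14.
  apply: run_if; rewrite [eval _ _ _]/= ltE => c'.
    apply: run_skip; rewrite E /= v2 // r1 leqNgt.
    by case: (threshold < _) c' => // _; rewrite orbF.
  apply: run_assign; rewrite E /= (small5 1) // leqNgt.
  by case: (threshold < _) c' => // _; rewrite orbT.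
by rewrite /=; nia.
Qed.

(** * Traversal of the path, [ord t] being the vertex at position [t] *)

Variables (ord : nat -> nat) (top : nat).
Hypothesis ord_lt : forall t, t < n -> ord t < n.
Hypothesis ord_succ : forall t, t.+1 < n -> arrs s0 asucc (ord t) = ord t.+1.
Hypothesis p_top : forall v i, v < n -> i < k -> mem_p v i <= top.
Hypothesis q_top : forall v, v < n -> mem_q v <= top.
Hypothesis top_small : n.+1 * top < B ^ L.+1.
Local Notation P := (fun t i => mem_p (ord t) i).
Local Notation Q := (fun t => mem_q (ord t)).

(** While position [t] is visited, entries are at most [t.+1 * top], and a candidate [F j + q v]
    adds one more [top]. This explains the factor [n.+1] in [top_small]. *)
Lemma sum_small t x y : t < n -> x <= t.+1 * top -> y <= top ->
  x + y < B ^ L.+1.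
Proof.
move=> tn xt yt; apply: leq_ltn_trans top_small; rewrite mulSn addnC.
by rewrite leq_add // (leq_trans xt) // leq_mul2r tn orbT.
Qed.

Lemma run_adds s t F : t < n -> good s -> vars s rcur = ord t -> holds s F ->
  (forall i, i < k -> F i <= t * top) ->
  run w (For rj rk add_p) s (k * (74 * L + 88) + 6) (fun s' =>
    holds s' (fun i => F i + mem_p (ord t) i)).
Proof.
move=> tn gs sv hs Ft; have [g1 g2 g3 g4] := gs.
apply: run_conseq.
  apply: (run_le (T := k * ((74 * L + 80) + 8) + 6)); first by nia.
  apply: (run_for (Inv := fun j s' =>
    holds s' (fun i => if i < j then F i + mem_p (ord t) i else F i))) => //.
    exact: k_lt.
  move=> j s1 jk ag1 s1j h1.
  have g1' : good s1.
    by apply: good_agree ag1 _ _ gs .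
  have [v1 _] := ag1.
  apply: run_conseq.
    apply: (run_add_p g1' h1 _ (ord_lt tn) s1j jk); first by rewrite v1.
    rewrite ltnn; apply: (sum_small tn); last by apply: p_top; rewrite ?ord_lt.
    by rewrite (leq_trans (Ft _ jk)) // leq_mul2r leqnSn orbT.
  move=> s2 _; apply: eq_holds => i ik /=.
  by rewrite ltnn ltnS; case: ltngtP => // ->.
by move=> s' _; apply: eq_holds => i ->.
Qed.

(** Invariant of the nested loops: the pairs lexicographically before [(i, j)] have been treated.
    The bound refers to the entries [F y] from before the loops, which is legitimate because entries
    only decrease. *)
Definition relaxed t F i j s := exists G, [/\ holds s G,
  attained k P Q t.+1 G, forall x, x < k -> G x <= F x &
  forall x y, x < k -> y < k -> (x < i) || (x == i) && (y < j) ->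
    G x <= F y + mem_q (ord t)].

Lemma run_relaxes s t F : t < n -> good s -> vars s rcur = ord t -> holds s F ->
  attained k P Q t.+1 F -> (forall i, i < k -> F i <= t.+1 * top) ->
  run w (For ri rk (For rj rk relax)) s
    (k * (k * (102 * L + 128) + 14) + 6) (relaxed t F k 0).
Proof.
move=> tn gs sv hs aF Ft; have [g1 g2 g3 g4] := gs.
apply: (run_le (T := k * ((k * ((102 * L + 120) + 8) + 6) + 8) + 6)).
  by nia.
apply: (run_for (Inv := fun i => relaxed t F i 0)) => //.
- exact: k_lt.
- by exists F; split=> // x y _ _; rewrite ltn0 andbF.
move=> i s1 ik ag1 s1i r1.
have g1' : good s1.
  by apply: good_agree ag1 _ _ gs .
have [v1 _] := ag1; have [_ g1k _ _] := g1'.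
apply: run_conseq.
  apply: (run_for (Inv := fun j => relaxed t F i j)) => //.
    exact: k_lt.
  move=> j s2 jk ag2 s2j [G [hG aG GF Gr]].
  have g2' : good s2.
    by apply: good_agree ag2 _ _ g1' .
  have [v2 _] := ag2.
  have s2i : vars s2 ri = i by rewrite v2.
  have s2v : vars s2 rcur = ord t by rewrite v2 ?v1.
  have qt := q_top (ord_lt tn).
  apply: run_conseq.
    apply: (run_relax g2' hG s2v (ord_lt tn) s2i ik s2j jk).
    by apply: (sum_small tn) => //; apply: leq_trans (Ft _ jk); apply: GF.
  move=> s3 _ h3.
  exists (if G j + mem_q (ord t) < G i then upd G i (G j + mem_q (ord t)) else G).
  split=> //.
  - by case: ifP => // _; apply: attained_relax.
  - move=> x xk; case: ifP => [lt /= | _]; last exact: GF.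
    by case: eqP => [-> | _]; [apply: leq_trans (GF _ ik); apply: ltnW | apply: GF].
  - move=> x y xk yk xy; have GFj := GF _ jk.
    (* For the current pair the bound comes from the comparison just made; any other pair was
       treated earlier, and the update can only lower its left-hand side. *)
    have [E | ne] := eqVneq (x, y) (i, j).
      case: E => xi yj; rewrite xi yj; case: ifP => [_ /= | /negbT].
        by rewrite eqxx leq_add2r.
      by rewrite -leqNgt => /leq_trans-> //; rewrite leq_add2r.
    have {}Gr : G x <= F y + mem_q (ord t).
      apply: Gr => //; move: xy ne; rewrite xpair_eqE.
      by case: (ltngtP x i) => //= _; rewrite ltnS leq_eqVlt => /orP[->|].
    case: ifP => // lt /=; case: eqP => // xi.
    by rewrite (leq_trans (ltnW lt)) // -xi.
(* Being at column [k] of row [i] amounts to being at column 0 of row [i.+1]. *)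
move=> s2 _ [G [hG aG GF Gr]]; exists G; split=> // x y xk yk xy.
apply: Gr => //; rewrite yk andbT orbC -leq_eqVlt.
by case/orP: xy; rewrite ?ltnS // andbF.
Qed.

Definition optimal t s := exists F, [/\ holds s F, attained k P Q t F,
  minorant k P Q t F & forall i, i < k -> F i <= t * top].

Lemma run_visit s t : t < n -> good s -> vars s rcur = ord t -> optimal t s ->
  run w visit s (300 * (k * k * L.+1)) (fun s' => optimal t.+1 s' /\
    vars s' rcur = arrs s0 asucc (ord t)).
Proof.
move=> tn gs sv [F [hF aF mF Ft]]; have [g1 g2 g3 g4] := gs.
eapply run_le; last first.
  apply: run_seq (run_adds tn gs sv hF Ft) _ => s1 ag1 h1.
  have g1' : good s1.
    by apply: good_agree ag1 _ _ gs .
  have [v1 _] := ag1.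
  have s1v : vars s1 rcur = ord t by rewrite v1.
  have pt i : i < k -> mem_p (ord t) i <= top by apply: p_top; rewrite ord_lt.
  have Ft1 i : i < k -> F i + mem_p (ord t) i <= t.+1 * top.
    by move=> ik; rewrite mulSn addnC leq_add ?Ft ?pt.
  apply: run_seq (run_relaxes tn g1' s1v h1 (attained_add aF) Ft1) _.
  move=> s2 ag2 [G [hG aG GF Gr]]; apply: run_assign => /=.
  have [v2 _] := ag2.
  have [_ _ _ a2] : good s2.
    by apply: good_agree ag2 _ _ g1' .
  split; last by rewrite v2 // s1v a2.
  exists G; split=> //.
    apply: minorant_relax mF _ _; first exact: GF.
    by move=> i j ik jk; apply: Gr; rewrite ?ik.
  by move=> i ik; apply: leq_trans (Ft1 _ ik); apply: GF.
rewrite /=; have : k <= k * k by rewrite leq_pmulr.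
by move: (k * k) (mulnA k k L) => kk; nia.
Qed.

Lemma run_visits s : good s -> vars s rcur = ord 0 -> holds s (fun=> 0) ->
  run w (For rt rn visit) s (n * (308 * (k * k * L.+1)) + 6) (optimal n).
Proof.
move=> gs sv hs; have [g1 g2 g3 g4] := gs.
apply: (run_le (T := n * (300 * (k * k * L.+1) + 8) + 6)).
  rewrite leq_add2r leq_mul2l; apply/orP; right.
  have : 0 < k * k * L.+1 by rewrite !muln_gt0 k_gt0.
  by move: (k * k * L.+1) => K; lia.
apply: run_conseq.
  (* The current vertex is specified only for [t < n]: after the last vertex there is no successor
     to load. *)
  apply: (run_for (Inv := fun t s' => optimal t s' /\
      (t < n -> vars s' rcur = ord t))) => //.
  - exact: n_lt.
  - split=> //; exists (fun=> 0); split=> //; exact: attained0.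
  move=> t s1 tn ag1 s1t [o1 /(_ tn) c1].
  have g1' : good s1 by apply: good_agree ag1 _ _ gs.
  apply: run_conseq (run_visit tn g1' c1 o1) _ => s2 _ [o2 c2].
  by split=> // t1; rewrite -ord_succ.
by move=> s' _ [].
Qed.

End Slots.

(* The first vertex is left in rcur: it is the sum of all the vertices minus the
   sum of the heads of the arcs. *)
Definition link :=
  For rt rm (
    Put asucc (Get asrc (Var rt)) (Get adst (Var rt)) ;;
    rcur ::= Op Add (Var rcur)
               (Op Defs.Sub (Op Add (Var rt) (Const 1)) (Get adst (Var rt)))).

(** A path with [m] arcs has the vertices [0] to [m], whose sum is that of the [u.+1] for [u < m].
    Partial results may wrap, hence the congruence. Distinct tails ensure that no successor is
    overwritten. *)
Lemma run_link w s m : vars s rm = m -> m < 2 ^ w -> vars s rcur = 0 ->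
  (forall u, u < m -> arrs s adst u < 2 ^ w) ->
  (forall u t, u < m -> t < m -> arrs s asrc u = arrs s asrc t -> u = t) ->
  run w link s (m * 24 + 6) (fun s' =>
    [/\ forall u, u < m -> arrs s' asucc (arrs s asrc u) = arrs s adst u,
      vars s' rcur < 2 ^ w &
      vars s' rcur + \sum_(u < m) arrs s adst u =
        \sum_(u < m) u.+1 %[mod 2 ^ w] ]).
Proof.
move=> sm mB sc dB src_inj; have B0 : 0 < 2 ^ w by rewrite expn_gt0.
apply: (run_le (T := m * (16 + 8) + 6)) => //.
apply: (run_for (Inv := fun i s' =>
  [/\ forall u, u < i -> arrs s' asucc (arrs s asrc u) = arrs s adst u,
      vars s' rcur < 2 ^ w &
      vars s' rcur + \sum_(u < i) arrs s adst u =
        \sum_(u < i) u.+1 %[mod 2 ^ w] ])) => //.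
  by split=> //=; rewrite ?sc // !big_ord0.
move=> i s1 im [v1 a1] s1i [I1 I2 I3].
eapply run_le; last first.
  apply: run_put_seq; apply: run_assign => /=; rewrite s1i (a1 1) // (a1 2) //=.
  split=> [u||]; last 2 first.
  - by rewrite ltn_pmod.
  - rewrite !big_ord_recr /= modnDml.
    have dBi := dB i im; set d := arrs s 2 i; set S := \sum_(u < i) _.
    set i1 := (i + _) %% _.
    have i1E : i1 = i.+1 %[mod 2 ^ w] by rewrite modn_mod modnDmr addn1.
    rewrite -modnDml -modnDmr modnDml modnDmr.
    rewrite -[in RHS]modnDml -I3 modnDml -[in RHS]modnDmr -i1E modnDmr.
    rewrite -modnDml modnDmr modnDml.
    (* The word [2 ^ w - d] stands for the negative of [d]; together with [d] it leaves a full
       [2 ^ w], which vanishes. *)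
    have -> : vars s1 6 + (i1 + (2 ^ w - d)) + (S + d) =
        2 ^ w + (vars s1 6 + S + i1) by move: dBi; rewrite -/d; lia.
    by rewrite modnDl.
  rewrite ltnS => ui; case: eqP => [E | ne].
    by rewrite (src_inj _ _ _ im E) // (leq_ltn_trans ui).
  by apply: I1; rewrite ltn_neqAle ui andbT; apply: contra_not_neq ne => ->.
by [].
Qed.

(** * Reading the input arrays *)

Lemma size_flatten_uniform (T : Type) (ss : seq (seq T)) L :
  all (fun s => size s == L) ss -> size (flatten ss) = size ss * L.
Proof.
by elim: ss => //= s ss IH /andP[/eqP sL /IH E]; rewrite size_cat sL E mulSn.
Qed.

Lemma nth_flatten_uniform (T : Type) x0 (ss : seq (seq T)) L i l :
  all (fun s => size s == L) ss -> i < size ss -> l < L ->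
  nth x0 (flatten ss) (i * L + l) = nth x0 (nth [::] ss i) l.
Proof.
move=> + + lL; elim: ss i => //= s ss IH [|i] /andP[/eqP sL /IH {}IH] ilt.
  by rewrite nth_cat sL lL.
rewrite nth_cat sL mulSn -addnA ltnNge leq_addr /= addnC addnK; exact: IH.
Qed.

Lemma nth_words w L x l : l < L ->
  nth 0 (words w L x) l = x %/ (2 ^ w) ^ l %% 2 ^ w.
Proof. by move=> lL; rewrite nth_mkseq // expnM. Qed.

Lemma words_lt w L x : all (fun d => d < 2 ^ w) (words w L x).
Proof. by apply/allP => d /mapP[l _ ->]; rewrite ltn_pmod ?expn_gt0. Qed.

Lemma nth_lt_all (b : nat) s m : 0 < b -> all (fun d => d < b) s -> nth 0 s m < b.
Proof.
move=> b0 sb; case: (ltnP m (size s)) => ms; last by rewrite nth_default.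
by move/(all_nthP 0): sb; apply.
Qed.

Lemma flatten_lt b (ss : seq (seq nat)) :
  all (all (fun d => d < b)) ss -> all (fun d => d < b) (flatten ss).
Proof. by elim: ss => //= s ss IH /andP[sb /IH]; rewrite all_cat sb. Qed.

Lemma lt_exp_bits x : x < 2 ^ bits x.
Proof. exact: trunc_log_ltn. Qed.

Lemma leq_nwords w m : 0 < w -> m <= w * nwords w m.
Proof.
move=> w0; rewrite /nwords mulnC; have := divn_eq m.-1 w.
by have := ltn_pmod m.-1 w0; rewrite mulSn; lia.
Qed.

(** Beyond the stored words the default value 0 is the true digit, so a short threshold is padded
    with zeros for free. *)
Lemma nth_number w x l : 0 < w ->
  nth 0 (Defs.number w x) l = x %/ (2 ^ w) ^ l %% 2 ^ w.
Proof.
move=> w0; have [lL | Ll] := ltnP l (nwords w (bits x)); first exact: nth_words.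
rewrite nth_default ?size_mkseq // divn_small ?mod0n // -expnM.
apply: leq_trans (lt_exp_bits x) _; rewrite leq_exp2l //.
by apply: leq_trans (leq_nwords _ w0) _; rewrite leq_mul2l Ll orbT.
Qed.

(** There are no leading zero words, so the length bounds the number from below. *)
Lemma size_number_gt w x L : 0 < w -> L.+1 < size (Defs.number w x) ->
  (2 ^ w) ^ L.+1 <= x.
Proof.
move=> w0; rewrite size_mkseq /nwords ltnS /bits /= leq_divRL // => Lx.
rewrite -expnM mulnC; case: x Lx => [|x Lx].
  by rewrite trunc_log0 leqn0 muln_eq0 (gtn_eqF w0).
apply: leq_trans (trunc_logP (isT : 1 < 2) (ltn0Sn x)).
by rewrite leq_exp2l.
Qed.

Lemma number_lt w x L : 0 < w -> size (Defs.number w x) <= L -> x < (2 ^ w) ^ L.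
Proof.
move=> w0; rewrite size_mkseq -expnM => xL.
apply: leq_trans (lt_exp_bits x) _; rewrite leq_exp2l //.
by apply: leq_trans (leq_nwords _ w0) _; rewrite leq_mul2l xL orbT.
Qed.

Section Input.
Variables (n k w : nat) (I : esp_input n k).
Hypothesis w_gt0 : 0 < w.
Local Notation s0 := (load w I).
Local Notation L := (nwords w (num_bits I)).

Let top := maxn (\max_v qnum I v) (\max_v \max_i pnum I v i).

Lemma qnum_top v : qnum I v <= top.
Proof. by rewrite leq_max (leq_bigmax v). Qed.

Lemma pnum_top v i : pnum I v i <= top.
Proof.
rewrite leq_max; apply/orP; right; apply: leq_trans (leq_bigmax v).
exact: (leq_bigmax i).
Qed.

Lemma top_lt : top < (2 ^ w) ^ L.
Proof.
rewrite -expnM; apply: leq_trans (lt_exp_bits _) _.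
by rewrite leq_exp2l // leq_nwords.
Qed.

Lemma load_q (v : 'I_n) : low w L s0 aq (v * L) = qnum I v.
Proof.
rewrite /low /=; transitivity (qnum I v %% (2 ^ w) ^ L); last first.
  by rewrite modn_small // (leq_ltn_trans (qnum_top v)) // top_lt.
rewrite -val_words_digits //; apply: eq_val_words => l lL.
rewrite nth_flatten_uniform //.
- by rewrite (nth_map v) ?size_enum_ord // nth_ord_enum nth_words.
- by apply/allP => s /mapP[x _ ->]; rewrite size_mkseq.
by rewrite size_map size_enum_ord.
Qed.

Lemma load_p (v : 'I_n) (i : 'I_k) :
  low w L s0 ap ((v * k + i) * L) = pnum I v i.
Proof.
rewrite /low /=; transitivity (pnum I v i %% (2 ^ w) ^ L); last first.
  by rewrite modn_small // (leq_ltn_trans (pnum_top v i)) // top_lt.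
rewrite -val_words_digits //; apply: eq_val_words => l lL.
set row := fun v => [seq words w L (pnum I v i) | i <- enum 'I_k].
have rowk : all (fun s => size s == k) (map row (enum 'I_n)).
  by apply/allP => s /mapP[x _ ->]; rewrite size_map size_enum_ord.
rewrite nth_flatten_uniform //.
- rewrite nth_flatten_uniform //; last by rewrite size_map size_enum_ord.
  rewrite (nth_map v) ?size_enum_ord // nth_ord_enum.
  by rewrite (nth_map i) ?size_enum_ord // nth_ord_enum nth_words.
- by apply/allP => s /allpairsP[x [_ _ ->]]; rewrite size_mkseq.
rewrite (size_flatten_uniform rowk) size_map size_enum_ord.
apply: leq_trans (_ : v.+1 * k <= _); last by rewrite leq_mul2r ltn_ord orbT.
by rewrite mulSn addnC ltn_add2r.
Qed.

(** Only the [L.+1] low-order words are read; the residue is the number itself when the threshold is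
    not longer than that. *)
Lemma load_r : low w L s0 ar 0 + arrs s0 ar L * (2 ^ w) ^ L =
  `|rint I| %% (2 ^ w) ^ L.+1.
Proof.
have rE l : arrs s0 ar l = `|rint I| %/ (2 ^ w) ^ l %% 2 ^ w.
  exact: nth_number.
rewrite -val_words_digits // val_wordsS rE; congr (_ + _).
by apply: eq_val_words => l _; rewrite rE.
Qed.

Lemma load_digits a m : a \in [:: aq; ap; ar] -> arrs s0 a m < 2 ^ w.
Proof.
rewrite !inE => aa; apply: nth_lt_all; first by rewrite expn_gt0.
case/or3P: aa => /eqP->.
- apply: flatten_lt; apply/allP => s /mapP[x _ ->]; exact: words_lt.
- apply: flatten_lt; apply/allP => s /allpairsP[x [_ _ ->]]; exact: words_lt.
exact: words_lt.
Qed.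

Lemma input_sizeE : input_size w I =
  9 + size (arcs I) + size (arcs I) + n * L + n * k * L +
  size (Defs.number w `|rint I|) + size (Defs.number w (rnum I)) +
  size (Defs.number w (rden I)) + size (Defs.number w (den I)).
Proof.
clear w_gt0.
rewrite /input_size /= !size_map addn0.
rewrite (@size_flatten_uniform _ [seq words _ _ _ | v <- _] L); last first.
  by apply/allP => s /mapP[x _ ->]; rewrite size_mkseq.
rewrite (@size_flatten_uniform _ [seq words _ _ _ | v <- _, i <- _] L); last first.
  by apply/allP => s /allpairsP[x [_ _ ->]]; rewrite size_mkseq.
rewrite size_allpairs size_map !size_enum_ord; lia.
Qed.

End Input.

(** * The objective on a path as a sum along positions *)

Section Cost.
Local Open Scope ring_scope.

(** With at most one successor, the only machine that [v] can hit is the one of that successor, so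
    [q v] is paid at most once. *)
Lemma tr_functional (R : realFieldType) (V : finType) k (e : rel V)
    (f : {ffun V -> 'I_k}) (q : V -> R) :
  (forall v u u', e v u -> e v u' -> u = u') ->
  tr f q e = \sum_v \sum_(u | e v u) q v * (f v != f u)%:R.
Proof.
move=> fun_e; rewrite /tr (exchange_big_dep xpredT) //=.
apply: eq_bigr => v _.
rewrite (big_pred1 (f v)) => [|i]; last by rewrite !inE eq_sym.
case: (pickP (e v)) => [u evu | no_u].
  rewrite [RHS](big_pred1 u) => [|u']; last first.
    by apply/idP/eqP => [evu' | ->]; [apply: fun_e evu' evu |].
  have hitE j : hits e v (f @^-1: [set j]) = (f u == j).
    apply/set0Pn/idP => [[u']|fu]; last by exists u; rewrite !inE evu.
    by rewrite !inE => /andP[/(fun_e _ _ _ evu)<-].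
  have [fvu | fvu] := eqVneq (f v) (f u).
    rewrite big1 ?mulr0 // => j; rewrite hitE -fvu eq_sym => /negPf->.
    by rewrite mulr0.
  rewrite (bigD1 (f u)) ?hitE ?eqxx 1?eq_sym //= big1 ?addr0 // => j.
  by rewrite hitE eq_sym => /andP[_ /negPf]; rewrite eq_sym => ->; rewrite mulr0.
rewrite [RHS]big_pred0 // big1 // => j _.
rewrite (_ : hits _ _ _ = false) ?mulr0 //; apply/negbTE; rewrite negbK.
by apply/eqP/setP => u; rewrite !inE no_u.
Qed.

(** [path_cost] also charges the step from the last position [n] to a fictitious position [n.+1];
    repeating the last label there makes this step free. *)
Lemma dipath_cost (R : realFieldType) n k (e : rel 'I_n.+1) (s : {perm 'I_n.+1})
    (f : {ffun 'I_n.+1 -> 'I_k}) p (q : 'I_n.+1 -> R) den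
    (P : nat -> nat -> nat) (Q : nat -> nat) (g : nat -> nat) :
  (forall u v, e u v = (s v == (s u).+1 :> nat)) ->
  (forall v, p v (f v) = (P (s v) (f v))%:R / den) ->
  (forall v, q v = (Q (s v))%:R / den) ->
  (forall v, g (s v) = f v) -> g n.+1 = g n ->
  \sum_v p v (f v) + tr f q e = (path_cost P Q n.+1 g)%:R / den.
Proof.
move=> es pE qE gE gn.
rewrite tr_functional => [|v u u']; last first.
  rewrite !es => /eqP su /eqP su'.
  by apply: (@perm_inj _ s); apply: val_inj; rewrite /= su su'.
rewrite -big_split /= /path_cost natr_sum mulr_suml.
rewrite [RHS](reindex_inj (@perm_inj _ s)) /=; apply: eq_bigr => v _.
rewrite natrD mulrDl pE -gE; congr (_ + _).
have [sv | sv] := ltnP (s v).+1 n.+1.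
  have [u su] : exists u, s u = (s v).+1 :> nat.
    by exists (s^-1%g (Ordinal sv)); rewrite permKV.
  rewrite (big_pred1 u) => [|u']; first by rewrite -su !gE qE natrM mulrC mulrA.
  by rewrite es -su; apply/eqP/eqP => [/val_inj/perm_inj | ->].
have svn : s v = n :> nat by apply/eqP; rewrite eqn_leq -ltnS ltn_ord.
rewrite svn gn eqxx mul0n mul0r big1 // => u; rewrite es svn => /eqP su.
by have := ltn_ord (s u); rewrite su ltnn.
Qed.

Lemma esp_dag_dipath (R : realFieldType) n k (e : rel 'I_n.+1)
    (s : {perm 'I_n.+1}) p (q : 'I_n.+1 -> R) r (I : esp_input n.+1 k.+1)
    (P : nat -> nat -> nat) (Q : nat -> nat) :
  (forall u v, e u v = (s v == (s u).+1 :> nat)) ->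
  encodes I e p q r ->
  (forall v i, pnum I v i = P (s v) i) -> (forall v, qnum I v = Q (s v)) ->
  esp_dag e p q r <->
  exists2 g, labelling k.+1 g & (path_cost P Q n.+1 g)%:Z <= rint I.
Proof.
move=> es [_ den_gt0 pE qE [rnum_lt rE]] PE QE.
have costE (f : {ffun 'I_n.+1 -> 'I_k.+1}) (g : nat -> nat) :
    (forall v, g (s v) = f v) -> g n.+1 = g n ->
    \sum_v p v (f v) + tr f q e = (path_cost P Q n.+1 g)%:R / (den I)%:R.
  by move=> *; apply: (dipath_cost es) => // v; rewrite ?pE ?qE ?PE ?QE.
(* In units of [1 / den I] the threshold is [rint I] plus a fraction in [[0, 1)], which an integer
   cost cannot detect. *)
have leE (x : nat) : (x%:R / (den I)%:R <= ratr r :> R) = (x%:Z <= rint I).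
  have d0 : 0 < (den I)%:R :> rat by rewrite ltr0n.
  have -> : x%:R / (den I)%:R = ratr (x%:R / (den I)%:R) :> R.
    by rewrite fmorph_div !rmorph_nat.
  rewrite ler_rat ler_pdivrMr // rE.
  have y0 : 0 <= (rnum I)%:R / (rden I)%:R :> rat by rewrite divr_ge0.
  have y1 : (rnum I)%:R / (rden I)%:R < 1 :> rat.
    by rewrite ltr_pdivrMr ?mul1r ?ltr_nat // ltr0n (leq_ltn_trans _ rnum_lt).
  have -> : x%:R = x%:Z%:~R :> rat by [].
  apply/idP/idP => [xy | xr].
    rewrite -ltzD1 -(ltr_int rat) rmorphD /=; apply: le_lt_trans xy _.
    by rewrite ltrD2l.
  by apply: ler_wpDr => //; rewrite ler_int.
split=> [[f] | [g gk gr]].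
  (* Capping positions at [n] extends the labelling constantly beyond the last vertex. *)
  pose g t := nat_of_ord (f (s^-1%g (inord (minn t n)))).
  rewrite (costE f g) ?leE => [fr|v|].
  - by exists g => // t; apply: ltn_ord.
  - rewrite /g (minn_idPl _) -1?ltnS ?ltn_ord //.
    by rewrite inord_val permK.
  - by rewrite /g minnn (minn_idPr _).
pose f : {ffun 'I_n.+1 -> 'I_k.+1} := [ffun v => inord (g (s v))].
(* Resetting the label at [n.+1] only removes the transfer charged to the last vertex. *)
exists f; pose h := upd g n.+1 (g n).
rewrite (costE f h) ?leE => [|v|].
- apply: le_trans gr; rewrite lez_nat path_cost_upd path_costS eqxx addn0.
  by rewrite leq_add2l leq_addr.
- by rewrite /h /= ltn_eqF // ffunE inordK ?gk.
- by rewrite /h /= eqxx ltn_eqF.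
Qed.

End Cost.

(** * The whole program, and the arc list of a path *)

Definition solver :=
  rn ::= Get aH (Const 0) ;;
  rk ::= Get aH (Const 1) ;;
  rm ::= Get aH (Const 2) ;;
  rL ::= Get aH (Const 3) ;;
  link ;;
  For rt rn visit ;;
  finish.

Section Arcs.
Variables (n k w : nat) (e : rel 'I_n.+1) (s : {perm 'I_n.+1}).
Variable I : esp_input n.+1 k.
Hypothesis es : forall u v, e u v = (s v == (s u).+1 :> nat).
Hypothesis arcs_uniq : uniq (arcs I).
Hypothesis arcsE : forall u v, ((u, v) \in arcs I) = e u v.

Definition nth_vertex t : 'I_n.+1 := (s^-1)%g (inord t).

Lemma nth_vertexK (v : 'I_n.+1) : nth_vertex (s v) = v.
Proof. by rewrite /nth_vertex inord_val permK. Qed.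

Lemma nth_vertex_inj t u : t <= n -> u <= n -> nth_vertex t = nth_vertex u -> t = u.
Proof. by move=> tn un /perm_inj /(congr1 val) /=; rewrite !inordK. Qed.

(** The arcs come in unknown order. Comparing them with the list in path order yields their number,
    the successors and the sum of the heads. *)
Lemma perm_arcs :
  perm_eq (arcs I) [seq (nth_vertex t, nth_vertex t.+1) | t <- iota 0 n].
Proof.
apply: uniq_perm => // [|[u v]].
  rewrite map_inj_in_uniq ?iota_uniq // => t t'; rewrite !mem_iota /= => tn t'n [].
  by move/nth_vertex_inj=> ->; rewrite // ltnW.
rewrite arcsE es; apply/eqP/mapP => [sv | [t]].
  exists (s u : nat); last by rewrite -sv !nth_vertexK.
  by rewrite mem_iota /= add0n -ltnS -sv ltn_ord.
rewrite mem_iota /= => tn [-> ->]; rewrite /nth_vertex !permKV !inordK //.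
exact: ltnW.
Qed.

Local Notation src := (arrs (load w I) asrc).
Local Notation dst := (arrs (load w I) adst).

Lemma size_arcs : size (arcs I) = n.
Proof. by rewrite (perm_size perm_arcs) size_map size_iota. Qed.

Lemma load_src a0 u : u < n -> src u = (nth a0 (arcs I) u).1.
Proof. by move=> un; rewrite /= (nth_map a0) ?size_arcs. Qed.

Lemma load_dst a0 u : u < n -> dst u = (nth a0 (arcs I) u).2.
Proof. by move=> un; rewrite /= (nth_map a0) ?size_arcs. Qed.

Lemma load_dst_lt u : u < n -> dst u < n.+1.
Proof. by move=> un; rewrite (load_dst (ord0, ord0)). Qed.

(** Arcs with equal tails have equal heads on a path, and no arc is listed twice. *)
Lemma load_src_inj u t : u < n -> t < n -> src u = src t -> u = t.
Proof.
move=> un tn; pose a0 : 'I_n.+1 * 'I_n.+1 := (ord0, ord0).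
rewrite !(load_src a0) // => /val_inj.
have := mem_nth a0 (_ : u < size (arcs I)).
have := mem_nth a0 (_ : t < size (arcs I)).
rewrite size_arcs => /(_ tn) + /(_ un).
case Et: (nth _ _ t) => [x y]; case Eu: (nth _ _ u) => [x' y'] /=.
rewrite !arcsE !es => /eqP yE /eqP y'E xx.
move: Et; rewrite -xx in yE *; have -> : y = y'.
  by apply: (@perm_inj _ s); apply: val_inj; rewrite /= yE y'E.
by move/eqP; rewrite -Eu nth_uniq ?size_arcs // => /eqP.
Qed.

Lemma load_succ t : t < n -> exists2 u, u < n &
  src u = nth_vertex t /\ dst u = nth_vertex t.+1.
Proof.
move=> tn; pose a := (nth_vertex t, nth_vertex t.+1).
have : a \in arcs I by rewrite (perm_mem perm_arcs) map_f // mem_iota.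
move=> aI; have ia : index a (arcs I) < n.
  by have := index_mem a (arcs I); rewrite size_arcs aI.
by exists (index a (arcs I)); rewrite ?(load_src a) ?(load_dst a) ?nth_index.
Qed.

(** Every vertex except the first is the head of exactly one arc. *)
Lemma sum_dst : nth_vertex 0 + \sum_(u < n) dst u = \sum_(u < n) u.+1.
Proof.
have -> : \sum_(u < n) dst u = \sum_(a <- arcs I) a.2.
  pose a0 : 'I_n.+1 * 'I_n.+1 := (ord0, ord0).
  rewrite (big_nth a0) big_mkord size_arcs.
  by apply: eq_bigr => u _; rewrite (load_dst a0).
rewrite (perm_big _ perm_arcs) big_map /= -[n in iota 0 n]subn0 big_mkord.
have <- : \sum_(t < n.+1) nth_vertex t = nth_vertex 0 + \sum_(t < n) nth_vertex t.+1.
  by rewrite big_ord_recl.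
transitivity (\sum_(t < n.+1) t); last by rewrite big_ord_recl.
rewrite [RHS](reindex_inj (@perm_inj _ (s^-1)%g)); apply: eq_bigr => t _.
by rewrite /nth_vertex inord_val.
Qed.

End Arcs.

(** * Correctness and running time *)

Lemma attained_has k P Q n F X : 0 < k ->
  attained k P Q n F -> minorant k P Q n F ->
  has (fun i => F i <= X) (iota 0 k) <->
  exists2 g, labelling k g & path_cost P Q n g <= X.
Proof.
move=> k_gt0 aF mF; split=> [/hasP[i] | [g gk gX]].
  rewrite mem_iota => /= ik FX; have [g [gk _ gF]] := aF i ik.
  by exists g => //; apply: leq_trans FX.
apply/hasP; exists (g n); first by rewrite mem_iota gk.
exact: leq_trans (mF g gk) gX.
Qed.

Lemma run_solver (R : realFieldType) n k (e : rel 'I_n.+1)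
    (p : 'I_n.+1 -> 'I_k.+1 -> R) (q : 'I_n.+1 -> R) (r : rat)
    (I : esp_input n.+1 k.+1) w :
  dipath e -> encodes I e p q r -> input_size w I < 2 ^ w ->
  run w solver (load w I) (1000 * (n.+1 * k.+1 ^ 3 * num_bits I)) (fun s' =>
    exists2 b : bool, vars s' 0 = b & b <-> esp_dag e p q r).
Proof.
move=> [s es] enc small; have [[uI arcsE] _ _ _ _] := enc.
(* The header alone takes nine words, and this already forces [w > 0]. *)
have B9 : 9 < 2 ^ w.
  apply: leq_ltn_trans small; rewrite input_sizeE; lia.
have w_gt0 : 0 < w by case: (w) B9.
pose L := nwords w (num_bits I); pose ord t : nat := nth_vertex s t.
have L_gt0 : 0 < L by [].
have L_le : L <= num_bits I.
  by rewrite /L /nwords /num_bits /bits /= ltnS leq_div.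
have sizeE := input_sizeE w I; rewrite (size_arcs es uI arcsE) in sizeE.
rewrite -/L in sizeE.
set s00 := load w I in sizeE *.
have v0 x : vars s00 x = 0 by [].
have z0 a m : 9 <= a -> arrs s00 a m = 0.
  by move=> a9; rewrite /= [nth [::] _ _]nth_default ?nth_nil.
have h0 : arrs s00 0 0 = n.+1 by [].
have h1 : arrs s00 0 1 = k.+1 by [].
have h2 : arrs s00 0 2 = n by rewrite -[RHS](size_arcs es uI arcsE).
have h3 : arrs s00 0 3 = L by [].
have h4 : arrs s00 0 4 = (rint I < 0)%R by [].
have h5 : arrs s00 0 5 = size (Defs.number w `|rint I|) by [].
have hq := load_q I w_gt0; rewrite -/s00 -/L in hq.
have hp := load_p I w_gt0; rewrite -/s00 -/L in hp.
have hr := load_r I w_gt0; rewrite -/s00 -/L in hr.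
have hd := @load_digits _ _ w I; rewrite -/s00 in hd.
have dlt := load_dst_lt w es uI arcsE; rewrite -/s00 in dlt.
have sinj := load_src_inj (w := w) es uI arcsE; rewrite -/s00 in sinj.
have succ := load_succ w es uI arcsE; rewrite -/s00 in succ.
have sumd := sum_dst w es uI arcsE; rewrite -/s00 in sumd.
(* From here on the initial store is known only through the facts collected above, which keeps
   simplification from unfolding it. *)
clearbody s00.
have small5 i : i < 6 -> i %% 2 ^ w = i by move=> i6; rewrite modn_small //; lia.
have nkL : n.+1 * k.+1 * L + n.+1 * L < 2 ^ w.
  by apply: leq_ltn_trans small; rewrite sizeE; lia.
have nB : n.+2 < 2 ^ w.
  apply: leq_ltn_trans small; rewrite sizeE.
  have : n.+1 <= n.+1 * L by rewrite leq_pmulr.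
  lia.
eapply run_le; last first.
  do 4 apply: run_assign_seq; rewrite /= !small5 // h0 h1 h2 h3.
  set s1 := set_var _ _ _.
  apply: run_seq.
    apply: (@run_link w s1 n); [by [] | lia | exact: v0 | | exact: sinj].
    by move=> u un; apply: leq_trans (dlt u un) _; lia.
  move=> s2 [/= v2 a2] [E1 E2 E3].
  (* Both sides are below [2 ^ w], so the congruence is an equality. *)
  have sc : vars s2 rcur = ord 0.
    move/eqP: E3; rewrite -sumd eqn_modDr !modn_small //; first by move/eqP.
    by apply: leq_trans (ltn_ord _) _; lia.
  have a2' a : a != 9 -> arrs s2 a = arrs s00 a.
    by move=> a9; rewrite a2 // inE.
  have gs : good n.+1 k.+1 L s2 s2 by split; rewrite ?v2.
  have digits a m : a \in [:: aq; ap; ar] -> arrs s2 a m < 2 ^ w.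
    by move=> aa; rewrite a2' ?hd //; move: aa; rewrite !inE => /or3P[]/eqP->.
  have zero m : arrs s2 aZ m = 0 by rewrite a2' // z0.
  have D0 : holds w k.+1 L s2 (fun=> 0).
    split=> [m|m|i _]; rewrite ?a2' ?z0 ?expn_gt0 //.
    by rewrite /low /val_words big1 // => l _; rewrite a2' // z0.
  pose top := maxn (\max_v qnum I v) (\max_v \max_i pnum I v i).
  have ord_lt t : t < n.+1 -> ord t < n.+1 by rewrite ltn_ord.
  have ord_succ t : t.+1 < n.+1 -> arrs s2 asucc (ord t) = ord t.+1.
    by move=> /succ[u un [su du]]; rewrite -[RHS]du -E1 // su.
  have pE (v : 'I_n.+1) (i : 'I_k.+1) : mem_p w k.+1 L s2 v i = pnum I v i.
    by rewrite -hp /mem_p /low a2'.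
  have qE (v : 'I_n.+1) : mem_q w L s2 v = qnum I v.
    by rewrite -hq /mem_q /low a2'.
  have p_top v i : v < n.+1 -> i < k.+1 -> mem_p w k.+1 L s2 v i <= top.
    by move=> vn ik; rewrite (pE (Ordinal vn) (Ordinal ik)) pnum_top.
  have q_top v : v < n.+1 -> mem_q w L s2 v <= top.
    by move=> vn; rewrite (qE (Ordinal vn)) qnum_top.
  (* The factor [n.+2] fits in one word and [top] in [L] words: one extra word per entry prevents
     overflow. *)
  have top_small : n.+2 * top < (2 ^ w) ^ L.+1.
    rewrite expnS; have := top_lt I w_gt0; rewrite -/top -/L => tL.
    apply: leq_ltn_trans (_ : 2 ^ w * top < _).
      by rewrite leq_mul2r ltnW ?orbT.
    by rewrite ltn_pmul2l ?expn_gt0.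
  apply: run_seq.
    by apply: (run_visits w_gt0 _ _ _ nkL digits zero ord_lt ord_succ
      p_top q_top top_small gs sc D0).
  move=> s3 ag3 [F [hF aF mF Ft]].
  have g3 : good n.+1 k.+1 L s2 s3 by apply: good_agree ag3 _ _ gs.
  apply: run_conseq.
    apply: (run_finish w_gt0 _ _ _ nkL digits g3 hF) => //.
      by have [v3 _] := ag3; rewrite v3 // v2 // v0.
    by lia.
  move=> s4 _ ->; eexists; first by [].
  rewrite !a2' // h4 h5 eqb0 negbK /threshold /low !a2' // -/(low w L s00 ar 0) hr.
  set P := fun t i => _ in aF mF; set Q := fun t => _ in aF mF.
  rewrite (esp_dag_dipath (P := P) (Q := Q) es enc); last 2 first.
  - by move=> v i; rewrite /P /ord nth_vertexK pE.
  - by move=> v; rewrite /Q /ord nth_vertexK qE.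
  case: ifP => [r0 | /negbT]; last rewrite -leNgt => r0.
    split=> // -[g _ gr]; move: r0; rewrite ltNge.
    by rewrite (le_trans _ gr).
  have rE : rint I = Posz `|rint I| by rewrite gez0_abs.
  have gE g : ((path_cost P Q n.+1 g)%:Z <= rint I)%R =
      (path_cost P Q n.+1 g <= `|rint I|).
    by rewrite rE lez_nat.
  have gh := attained_has `|rint I| (ltn0Sn k) aF mF.
  (* If the threshold has more than [L.+1] words, it is at least [(2 ^ w) ^ L.+1], hence above entry
     0 of the final table, and the answer 1 is correct. *)
  case: ifP => [big_r | /negbT].
    have {}big_r := size_number_gt w_gt0 big_r.
    have /gh[g gk gr] : has (fun i => F i <= `|rint I|) (iota 0 k.+1).
      rewrite /=; apply/orP; left; apply: leq_trans (Ft 0 isT) _.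
      apply: leq_trans big_r; apply: ltnW; apply: leq_ltn_trans top_small.
      by rewrite leq_mul2r leqnSn orbT.
    by split=> // _; exists g; rewrite ?gE.
  rewrite -leqNgt => /(number_lt w_gt0) => r_lt; rewrite modn_small // gh.
  by split=> -[g gk gr]; exists g; rewrite // ?gE // -gE.
rewrite /= !addnA; set M := num_bits I in L_le *.
have -> : k.+1 ^ 3 = k.+1 * k.+1 * k.+1 by rewrite !expnS expn0 muln1 mulnA.
move: (k.+1 * k.+1) (leq_pmulr (k.+1) (ltn0Sn k)) => kk kk_ge.
(* A visit takes a constant times [kk * L.+1] steps, where [kk] is the square of the number of
   machines, and [L.+1 <= 2 * M] since [L <= M] and [M > 0]. The third factor [k.+1] is slack. *)
have kM : kk * L.+1 <= 2 * (kk * k.+1 * M).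
  apply: leq_trans (_ : kk * (2 * M) <= _); first by rewrite leq_mul2l; lia.
  by rewrite mulnCA leq_mul2l /= leq_mul2r leq_pmulr // orbT.
have A_ge : k.+1 * L.+1 <= kk * L.+1 by rewrite leq_mul2r kk_ge orbT.
have A_gt0 : 0 < kk * L.+1 by apply: leq_trans A_ge.
move: (k.+1 * L.+1) (kk * L.+1) A_ge A_gt0 kM => a A aA A0 AM.
rewrite -[n.+1 * (kk * k.+1) * M]mulnA; move: (kk * k.+1 * M) AM => m AM.
have nA : n.+1 * A <= n.+1 * (2 * m) by rewrite leq_mul2l AM orbT.
have : A <= n.+1 * A by rewrite leq_pmull.
have : n.+1 <= n.+1 * A by rewrite leq_pmulr.
rewrite [n.+1 * (308 * A)]mulnCA; move: nA; rewrite mulnCA.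
by move: (n.+1 * A) (n.+1 * m) => b c; lia.
Qed.

Theorem theorem3 :
  exists (c : cmd) (C : nat),
    forall (R : realFieldType) (n k : nat) (e : rel 'I_n)
      (p : 'I_n -> 'I_k -> R) (q : 'I_n -> R) (r : rat)
      (I : esp_input n k) (w : nat),
      0 < n -> 0 < k -> dipath e -> encodes I e p q r ->
      input_size w I < 2 ^ w ->
      decides_within w c (load w I) (C * (n * k ^ 3 * num_bits I))
        (esp_dag e p q r).
Proof.
exists solver, 1000 => R [//|n] [//|k] e p q r I w _ _ de enc small.
have [m [s' [ex mT [b bE bA]]]] := run_solver de enc small.
exists m, s'; split=> //; rewrite bE.
by case: b bA {bE} => bA; [left | right]; split=> //; [apply/bA | move/bA].
Qed.
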